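(* There exist three real conics $Q_1,Q_2,Q_3\subseteq\mathbb{R}^2$ such that there are $136$ real circles tangent to these three conics; that is, the number of real circles tangent to all of $Q_1,Q_2,Q_3$ is $136$.
   Context: A conic in the plane is the zero set of a polynomial $Q(x,y)=ax^2+bxy+cy^2+dx+ey+f$; it is real if the coefficients $a,b,c,d,e,f$ are real. A circle with center $(s,t)$ and radius $r$ is the zero set of $C(x,y)=(x-s)^2+(y-t)^2-r^2$; it is real if $s,t,r$ are real. The circle $C$ is tangent to the conic $Q$ at the point $(u,v)$ if $Q(u,v)=C(u,v)=0$ and $\det\big([\nabla Q(u,v)\ \ \nabla C(u,v)]\big)=0$, where $\nabla$ denotes the gradient with respect to $(x,y)$. Real circles tangent to three real conics correspond to real values of $(u_1,v_1,u_2,v_2,u_3,v_3,s,t,r)$ such that the circle with center $(s,t)$ and radius $r$ is tangent to $Q_i$ at $(u_i,v_i)$ for $i=1,2,3$. *)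

(* Defs.v *)
From HB Require Import structures.
From mathcomp Require Import all_boot all_order all_algebra.
From mathcomp Require Import all_classical all_reals all_analysis.

Set Implicit Arguments.
Unset Strict Implicit.
Unset Printing Implicit Defensive.

Import Order.TTheory GRing.Theory Num.Theory.
Import numFieldNormedType.Exports.
Local Open Scope classical_set_scope.
Local Open Scope ring_scope.

(* Bivariate polynomials are represented by their polynomial functions, which
   determine them because R is infinite. Tangency is a property of the
   equation and not only of its zero locus. *)
Definition zero_set (R : realType) (F : R -> R -> R) : set (R * R) :=
  [set p | F p.1 p.2 = 0].

(* Q is the equation of a real conic: the quadratic part is nonzero, but
   singular conics and conics without real points are not excluded. *)
Definition real_conic (R : realType) (Q : R -> R -> R) : Prop :=
  exists a b c d e f : R,
    (a, b, c) <> (0, 0, 0) /\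
    forall x y, Q x y =
      a * x ^+ 2 + b * x * y + c * y ^+ 2 + d * x + e * y + f.

Definition circle_eq (R : realType) (s t r x y : R) : R :=
  (x - s) ^+ 2 + (y - t) ^+ 2 - r ^+ 2.

Definition gradient (R : realType) (F : R -> R -> R) (u v : R) : 'cV[R]_2 :=
  \col_(i < 2) if i == 0 then derive1 (fun x => F x v) u
               else derive1 (fun y => F u y) v.

Definition tangent_at (R : realType) (Q C : R -> R -> R) (u v : R) : Prop :=
  [/\ Q u v = 0, C u v = 0
    & \det (row_mx (gradient Q u v) (gradient C u v) : 'M[R]_2) = 0].

(* A circle is a set of points, so that (s, t, r) and (s, t, - r) count once.
   The points of tangency are real, and two circles are not distinguished by
   their points of tangency. *)
Definition tangent_circles (R : realType) (Q1 Q2 Q3 : R -> R -> R) :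
    set (set (R * R)) :=
  [set K | exists s t r : R,
     K = zero_set (circle_eq s t r) /\
     exists u1 v1 u2 v2 u3 v3 : R,
       [/\ tangent_at Q1 (circle_eq s t r) u1 v1,
           tangent_at Q2 (circle_eq s t r) u2 v2
         & tangent_at Q3 (circle_eq s t r) u3 v3]].

(* Main.v *)
Require Import Defs.
From HB Require Import structures.
From mathcomp Require Import all_boot all_order all_algebra.
From mathcomp Require Import all_classical all_reals all_analysis.
From mathcomp Require Import ring lra.

Set Implicit Arguments.
Unset Strict Implicit.
Unset Printing Implicit Defensive.

Import Order.TTheory GRing.Theory Num.Theory.
Import numFieldNormedType.Exports.
Local Open Scope classical_set_scope.
Local Open Scope ring_scope.

(** On the sides of the triangle with vertices (0, 0), (8, 0) and (0, 6) choose
    the points P1 = (1, 0), P2 = (0, 1) and P3 = (4, 3), and let the i-th conic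
    be the hyperbola Y^2 = e^2 (X^2 - e^2), where X is measured along the i-th
    side line from Pi, Y across it, and e > 0 is small.  As e tends to 0 the
    conic collapses onto the doubled side line, and its two vertices merge
    in Pi.  A circle touching it converges to a circle that touches the line
    or passes through Pi.  So the limit problem asks, for each of the 2^3 ways
    to choose a type of contact per side, for the circles with these contacts:
    there are 4 touching three lines, 2 touching two given lines and passing
    through the third point (3 choices), 2 touching one given line and passing
    through the two other points (3 choices), and 1 through three points,
    17 in all ([limit_listP]).

    Each limit contact comes from two contacts for e > 0: the two sides
    Y = e X and Y = - e X of the thin hyperbola near a tangency with the line,
    its two vertices near a passage through the point.  Hence each limit circle
    is approached by 2^3 touching circles, and the total is 17 * 8 = 136.

    This is made precise with unknowns rescaled according to the type of
    contact, in which the tangency equations become polynomial in e and in the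
    unknowns up to e = 0 ([contact_system]).  Three facts carry the proof.
    - At e = 0 the 136 zeros are regular, since the three contact points of a
      limit circle are not collinear ([contact_kernel]); so each continues to
      a unique zero for small e, by contraction ([label_persists]).
    - No other circle touches: otherwise such circles would exist for
      arbitrarily small e, and along an ultrafilter they would converge,
      contacts included, to one of the 136 zeros ([labels_exhaust]).  The
      circles cannot become unbounded ([touching_circles_bounded]): a limit line
      would be parallel to the side or pass through the point, for each of the
      three sides, which the position of the points excludes, and a circle
      growing without approaching a line would, seen from afar, touch three
      distinct lines through one point ([no_three_equal_projections]).
    - The 136 circles are distinct, because to first order in e the two contacts
      move the circle off its limit condition by opposite amounts
      ([offset_limit]). *)

(** * Limits along ultrafilters *)

(** Convergence under a rigid head symbol, on which [solve_tends] can match the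
    expressions of the function and of the limit in parallel. *)
Definition tends (R : realType) (I : Type) (U : set_system I) (f : I -> R) (l : R) : Prop :=
  f @ U --> l.

Section Tends.
Variables (R : realType) (I : Type) (U : set_system I).
Context {properU : ProperFilter U}.
Implicit Types f g : I -> R.

Lemma tends_cst (l : R) : tends U (fun=> l) l.
Proof. exact: cvg_cst. Qed.

Lemma tendsD f g (l m : R) :
  tends U f l -> tends U g m -> tends U (fun i => f i + g i) (l + m).
Proof. exact: cvgD. Qed.

Lemma tendsN f (l : R) : tends U f l -> tends U (fun i => - f i) (- l).
Proof. exact: cvgN. Qed.

Lemma tendsM f g (l m : R) :
  tends U f l -> tends U g m -> tends U (fun i => f i * g i) (l * m).
Proof. exact: cvgM. Qed.

Lemma tendsX f (l : R) n : tends U f l -> tends U (fun i => f i ^+ n) (l ^+ n).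
Proof.
move=> fl; elim: n => [|n IHn].
  by rewrite expr0; under eq_fun do rewrite expr0; exact: tends_cst.
by rewrite exprS; under eq_fun do rewrite exprS; exact: tendsM.
Qed.

Lemma tendsV f (l : R) : l != 0 -> tends U f l -> tends U (fun i => (f i)^-1) l^-1.
Proof. by move=> l0; exact: cvgV. Qed.

Lemma tends_near f g (l : R) :
  tends U g l -> (\forall i \near U, f i = g i) -> tends U f l.
Proof.
move=> gl fg; move: gl; rewrite /tends; apply: cvg_trans; apply: near_eq_cvg.
by apply: filterS fg => i ->.
Qed.

Lemma tends_unique f g (l m : R) :
  tends U f l -> tends U g m -> (\forall i \near U, f i = g i) -> l = m.
Proof.
move=> fl gm fg; have := tends_near gm fg; rewrite /tends.
by apply: cvg_unique fl; exact: norm_hausdorff.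
Qed.

Lemma tends_eq f (l c : R) : tends U f l -> (\forall i \near U, f i = c) -> l = c.
Proof. by move=> fl; apply: tends_unique fl _; exact: tends_cst. Qed.

Lemma tends_neq0 f (l : R) : tends U f l -> l != 0 ->
  \forall i \near U, f i != 0.
Proof.
move=> fl l0; have lgt0 : 0 < `|l| by rewrite normr_gt0.
have /cvgrPdist_lt/(_ _ lgt0) := fl; apply: filterS => i; apply: contraTneq => ->.
by rewrite subr0 ltxx.
Qed.

Lemma tends_norm f (l : R) : tends U f l -> tends U (fun i => `|f i|) `|l|.
Proof. exact: cvg_norm. Qed.

End Tends.

Lemma tends_right_id (R : realType) (U : set_system R) :
  0^'+ `<=` U -> tends U (fun e => e) 0.
Proof.
by move=> U_right; apply: (cvg_trans _ (@cvg_at_right_filter R R id 0 0 cvg_id)) => A;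
  exact: U_right.
Qed.

Lemma mx_entry_tends (R : realType) m n (I : Type) (U : set_system I)
    (phi : I -> 'M[R]_(m, n)) (x0 : 'M[R]_(m, n)) r k :
  phi @ U --> x0 -> tends U (fun e => phi e r k) (x0 r k).
Proof.
move=> phi_cvg.
exact: (@cvg_comp _ _ _ phi (fun x : 'M[R]_(m, n) => x r k) _ _ _ phi_cvg
  (@coord_continuous _ _ _ r k x0)).
Qed.

Arguments mx_entry_tends {R m n I U phi x0} r k _.

Ltac solve_tends := lazymatch goal with
  | H : tends ?U ?f _ |- tends ?U ?f _ => exact H
  | H : tends ?U ?f _ |- tends ?U (fun i => ?f i) _ => exact H
  | |- tends ?U (fun i => ?q ?k i) _ =>
      match goal with H : forall k, tends _ _ _ |- _ => exact (H k) end
  | |- tends ?U (fun i => @?f i + @?g i) (?l + ?m) =>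
      refine (@tendsD _ _ U _ f g l m _ _); cbv beta; solve_tends
  | |- tends ?U (fun i => @?f i * @?g i) (?l * ?m) =>
      refine (@tendsM _ _ U _ f g l m _ _); cbv beta; solve_tends
  | |- tends ?U (fun i => - @?f i) (- ?l) =>
      refine (@tendsN _ _ U _ f l _); cbv beta; solve_tends
  | |- tends ?U (fun i => @?f i ^+ ?n) (?l ^+ _) =>
      refine (@tendsX _ _ U _ f l n _); cbv beta; solve_tends
  | |- tends ?U (fun i => (@?f i)^-1) (?l ^-1) =>
      refine (@tendsV _ _ U _ f l _ _); cbv beta; [idtac|solve_tends]
  | |- tends ?U (fun i => _) _ => exact (@tends_cst _ _ U _ _)
  end.

(** A filter is the intersection of the ultrafilters above it.  Statements about
    all small [e] are proved through this lemma, since along an ultrafilter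
    every bounded function converges and no subsequences are needed. *)
Lemma near_ultra (T : Type) (F : set_system T) (P : set T) : Filter F ->
  (forall U : set_system T, UltraFilter U -> F `<=` U -> U P) -> F P.
Proof.
move=> FF ultraP; apply: contrapT => nFP.
have properW : ProperFilter (within (~` P) F).
  apply: Build_ProperFilter => W; apply: nFP.
  have {}W : F [set x | (~` P) x -> False] := W.
  by apply: filterS W => x nPx; apply: contrapT.
have [U [ultraU FU]] := ultraFilterLemma properW.
have UP : U P by apply: ultraP => // A FA; apply: FU; exact: filterS FA.
have UnP : U (~` P) by apply: FU; exact: withinT.
by have /filter_ex [x []] : U (P `&` ~` P) by exact: filterI.
Qed.

Section UltraLimits.
Variables (R : realType) (I : Type) (U : set_system I).
Hypothesis ultraU : UltraFilter U.
Implicit Types f g : I -> R.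

Lemma ultra_bounded_cvg f (M : R) :
  (\forall i \near U, `|f i| <= M) -> exists l : R, tends U f l.
Proof.
move=> fM.
have ultraf : UltraFilter (f @ U).
  split; first exact: fmap_proper_filter.
  move=> G GF fUG; rewrite predeqE => A; split; last exact: fUG.
  move=> GA; have [//|UnA] := in_ultra_setVsetC (f @^-1` A) ultraU.
  by have /filter_ex [x []] : G (A `&` ~` A) by apply: filterI => //; exact: fUG.
have cM : compact `[- M, M]%classic by exact: segment_compact.
rewrite compact_ultra in cM; have [|l [_ fl]] := cM (f @ U) ultraf; last by exists l.
by apply: filterS fM => i; rewrite ler_norml /= in_itv.
Qed.

(** A real function either converges along an ultrafilter or tends to infinity in
    absolute value. *)
Lemma ultra_dichotomy f :
  (exists l : R, tends U f l) \/
  (\forall i \near U, f i != 0) /\ tends U (fun i => (f i)^-1) 0.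
Proof.
have [[M fM]|unbounded] := pselect (exists M, \forall i \near U, `|f i| <= M).
  by left; exact: ultra_bounded_cvg fM.
have big M : \forall i \near U, M < `|f i|.
  have [UM|] := in_ultra_setVsetC [set i | M < `|f i|] ultraU; first by [].
  move=> UM; exfalso; apply: unbounded; exists M.
  by apply: filterS UM => i /= /negP; rewrite -leNgt.
right; split; first by apply: filterS (big 0) => i; rewrite normr_gt0.
apply/cvgrPdist_lt => e e0; apply: filterS (big e^-1) => i fi.
have ei0 : 0 < e^-1 by rewrite invr_gt0.
by rewrite sub0r normrN normfV -[e]invrK ltf_pV2// posrE (lt_trans ei0 fi).
Qed.

Lemma ultra_sqr_cvg f (l : R) :
  tends U (fun i => f i ^+ 2) l -> exists2 l' : R, tends U f l' & l' ^+ 2 = l.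
Proof.
move=> f2.
have [l' fl'] : exists l' : R, tends U f l'.
  apply: (@ultra_bounded_cvg _ (l + 2)).
  have /cvgrPdist_le/(_ 1 ltr01) := f2; apply: filterS => i /=.
  rewrite distrC ler_norml -[f i ^+ 2]real_normK ?num_real// => /andP[_].
  have := normr_ge0 (f i); nra.
exists l' => //; apply: cvg_unique f2; first exact: norm_hausdorff.
exact: (cvgM fl' fl').
Qed.

End UltraLimits.

(** * A circle touching one collapsing hyperbola *)

Section Touching.
Variable R : realType.
Implicit Types e a al be p X Y : R.

(** Tangency, at the point [(X, Y)], of the hyperbola [Y^2 = e^2 (X^2 - e^2)] and of
    the curve [a (X^2 + Y^2) + al X + be Y + p = 0]: both equations, and the
    determinant of the gradients up to a factor 2.  The leading coefficient [a]
    is 1 for a circle; after normalising all coefficients, [a] tending to 0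
    describes circles that degenerate to a line or escape to infinity. *)
Definition touches e a al be p X Y : Prop :=
  [/\ Y ^+ 2 = e ^+ 2 * (X ^+ 2 - e ^+ 2),
      a * (X ^+ 2 + Y ^+ 2) + al * X + be * Y + p = 0
    & e ^+ 2 * X * (2 * a * Y + be) + Y * (2 * a * X + al) = 0].

(** The order of magnitude of the abscissa of the contact: 1 for a limit contact with
    the line, where the contact stays away from the vertices, and [e] for a
    limit contact with the point, where it stays near a vertex. *)
Definition along_scale (line : bool) e : R := if line then 1 else e.

(** At [e = 0] the restriction [X^2 + al X + p] of the circle to the line [Y = 0]
    has a double root, or vanishes at the origin. *)
Definition limit_contact (line : bool) al p : Prop :=
  if line then al ^+ 2 = 4 * p else p = 0.

(** Limits of the rescaled coordinates [X / along_scale] and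
    [Y / (e * along_scale)] of a contact.  The bit [sg] tells the two sides
    [Y = e X] and [Y = - e X] apart, or the two vertices [X = e] and [X = - e]. *)
Definition contact_u (line sg : bool) al : R :=
  if line then - al / 2 else (-1) ^+ sg.

Definition contact_v (line sg : bool) al : R :=
  if line then (-1) ^+ sg * (- al / 2) else 0.

Lemma sqr_eq_sign (x y : R) : x ^+ 2 = y ^+ 2 -> exists b : bool, x = (-1) ^+ b * y.
Proof.
by move/eqP; rewrite eqf_sqr => /orP[] /eqP ->; [exists false|exists true];
  rewrite ?expr0 ?expr1 ?mul1r ?mulN1r.
Qed.

Variables (I : Type) (U : set_system I).
Hypothesis ultraU : UltraFilter U.
Variables e al be p X Y : I -> R.
Hypothesis e_gt0 : \forall i \near U, 0 < e i.
Hypothesis e_to0 : tends U e (0 : R).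
Variables al0 be0 p0 : R.
Hypothesis al_cvg : tends U al al0.
Hypothesis be_cvg : tends U be be0.
Hypothesis p_cvg : tends U p p0.

Section Bounded.
Hypothesis touch : \forall i \near U, touches (e i) 1 (al i) (be i) (p i) (X i) (Y i).
Hypothesis not_both : ~ (al0 = 0 /\ p0 = 0).

(** Convergence of the contact.  The abscissa is bounded because the circle is.  If its
    limit [X0] is nonzero, then [Y / e] tends to [X0] or [- X0], and the tangency
    equation divided by [e] forces [al0 = - 2 * X0].  If [X0 = 0], then the
    circle equation gives [p0 = 0], the tangency equation makes [Y / e^2] tend
    to 0, and then the equation of the hyperbola makes [(X / e)^2] tend to 1. *)
Lemma contact_limit : exists line sg,
  [/\ limit_contact line al0 p0,
      tends U (fun i => X i / along_scale line (e i)) (contact_u line sg al0)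
    & tends U (fun i => Y i / (e i * along_scale line (e i))) (contact_v line sg al0)].
Proof.
have [X0 Xcvg] : exists X0 : R, tends U X X0.
  have [D Dcvg] : exists D : R, tends U (fun i => al i ^+ 2 / 4 + be i ^+ 2 / 4 - p i) D.
    by exists (al0 ^+ 2 / 4 + be0 ^+ 2 / 4 - p0); solve_tends.
  have [|N Ncvg] := @ultra_bounded_cvg _ _ _ ultraU (fun i => X i + al i / 2) (D + 2).
    have /cvgrPdist_le/(_ 1 ltr01) := Dcvg.
    move=> Dle; apply: filterS (filterI Dle touch) => i [] /=.
    rewrite distrC ler_norml => /andP[_ le1] [_ h _].
    have : (X i + al i / 2) ^+ 2 <= D + 1.
      have := sqr_ge0 (Y i + be i / 2); nra.
    rewrite -[X in X <= _]real_normK ?num_real//.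
    have := normr_ge0 (X i + al i / 2); nra.
  exists (N - al0 / 2); apply: (@tends_near _ _ _ _ _ (fun i => X i + al i / 2 - al i / 2)).
    by solve_tends.
  by apply: nearW => i; rewrite addrK.
pose y i := Y i / e i.
have [y0 ycvg y0E] : exists2 y0 : R, tends U y y0 & y0 ^+ 2 = X0 ^+ 2 - 0 ^+ 2.
  apply: (ultra_sqr_cvg ultraU).
  apply: (@tends_near _ _ _ _ _ (fun i => X i ^+ 2 - e i ^+ 2)).
    by solve_tends.
  apply: filterS (filterI e_gt0 touch) => i [e0 [h _ _]].
  by rewrite /y expr_div_n h mulrC mulKf// expf_neq0// gt_eqF.
rewrite expr0n subr0 in y0E.
have circ0 : X0 ^+ 2 + al0 * X0 + p0 = 0.
  have lim : tends U (fun i => X i ^+ 2 + e i ^+ 2 * y i ^+ 2 + al i * X i + be i * (e i * y i) + p i)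
    (X0 ^+ 2 + 0 ^+ 2 * y0 ^+ 2 + al0 * X0 + be0 * (0 * y0) + p0) by solve_tends.
  suff : X0 ^+ 2 + 0 ^+ 2 * y0 ^+ 2 + al0 * X0 + be0 * (0 * y0) + p0 = 0 by move=> <-; ring.
  apply: (tends_eq lim).
  apply: filterS (filterI e_gt0 touch) => i [e0 [_ h _]].
  have e0' : e i != 0 by rewrite gt_eqF.
  by rewrite -h /y; field.
have [X00|X00] := eqVneq X0 0.
  have p00 : p0 = 0 by move: circ0; rewrite X00; lra.
  have al00 : al0 != 0 by apply/eqP => al00; apply: not_both.
  pose v i := Y i / (e i * e i).
  have vcvg : tends U v (0 : R).
    have lim : tends U (fun i => - X i * (2 * (e i * y i) + be i) / (2 * X i + al i))
    (- X0 * (2 * (0 * y0) + be0) / (2 * X0 + al0)).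
      by solve_tends; rewrite X00 mulr0 add0r.
    rewrite X00 oppr0 !mul0r in lim.
    apply: (tends_near lim).
    have den : \forall i \near U, 2 * X i + al i != 0.
      apply: (@tends_neq0 _ _ _ _ _ (2 * X0 + al0)); first by solve_tends.
      by rewrite X00 mulr0 add0r.
    apply: filterS (filterI den (filterI e_gt0 touch)) => i [d0 [e0 [_ _ h]]].
    have e0' : e i != 0 by rewrite gt_eqF.
    rewrite /v /y; apply/eqP; rewrite eqr_div// ?mulf_neq0//; apply/eqP.
    have -> : e i * (Y i / e i) = Y i by field.
    lra.
  have [u0 ucvg u0E] : exists2 u0 : R, tends U (fun i => X i / e i) u0 & u0 ^+ 2 = 0 ^+ 2 + 1.
    apply: (ultra_sqr_cvg ultraU).
    apply: (@tends_near _ _ _ _ _ (fun i => v i ^+ 2 + 1)).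
      by solve_tends.
    apply: filterS (filterI e_gt0 touch) => i [e0 [h _ _]].
    have e0' : e i != 0 by rewrite gt_eqF.
    by rewrite /v !expr_div_n h; field.
  have [|sg sgE] := @sqr_eq_sign u0 1; first by rewrite u0E; ring.
  exists false, sg; split=> //=.
  by rewrite -[_ ^+ _]mulr1 -sgE.
have al0E : al0 = - 2 * X0.
  have lim : tends U (fun i => y i * (2 * X i + al i) + e i * X i * (2 * (e i * y i) + be i))
    (y0 * (2 * X0 + al0) + 0 * X0 * (2 * (0 * y0) + be0)) by solve_tends.
  have : y0 * (2 * X0 + al0) + 0 * X0 * (2 * (0 * y0) + be0) = 0.
    apply: (tends_eq lim).
    apply: filterS (filterI e_gt0 touch) => i [e0 [_ _ h]].
    have e0' : e i != 0 by rewrite gt_eqF.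
    apply: (mulfI e0'); rewrite mulr0 -[RHS]h /y; by field.
  have y00 : y0 != 0 by rewrite -sqrf_eq0 y0E sqrf_eq0.
  rewrite !mul0r addr0 => /eqP; rewrite mulf_eq0 (negPf y00) /= => /eqP; lra.
have [sg sgE] := sqr_eq_sign y0E.
have X0E : X0 = - al0 / 2 by rewrite al0E; field.
exists true, sg; split => /=.
- move: circ0; rewrite al0E; nra.
- by rewrite -X0E; apply: (tends_near Xcvg); apply: nearW => i; rewrite divr1.
- by rewrite -X0E -sgE; apply: (tends_near ycvg); apply: nearW => i; rewrite mulr1.
Qed.

End Bounded.
End Touching.

Section Infinity.
Variable R : realType.
Variables (I : Type) (U : set_system I).
Hypothesis ultraU : UltraFilter U.
Variables e a al be p X Y : I -> R.
Hypothesis e_gt0 : \forall i \near U, 0 < e i.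
Hypothesis e_to0 : tends U e 0.
Variables al0 be0 p0 : R.
Hypothesis a_to0 : tends U a 0.
Hypothesis al_cvg : tends U al al0.
Hypothesis be_cvg : tends U be be0.
Hypothesis p_cvg : tends U p p0.
Hypothesis touch :
  \forall i \near U, touches (e i) (a i) (al i) (be i) (p i) (X i) (Y i).

(** The leading coefficient tends to 0, so a contact that stays bounded tends to a
    point of the axis on the line [al0 X + be0 Y + p0 = 0], and the tangency
    equation divided by [e] tends to [al0 * X0 = 0], up to sign. *)
Lemma bounded_contact_limit X0 : tends U X X0 -> al0 * X0 + p0 = 0 /\ (al0 = 0 \/ X0 = 0).
Proof.
move=> Xcvg; pose y i := Y i / e i.
have [y0 ycvg y0E] : exists2 y0 : R, tends U y y0 & y0 ^+ 2 = X0 ^+ 2 - 0 ^+ 2.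
  apply: (ultra_sqr_cvg ultraU).
  apply: (@tends_near _ _ _ _ _ (fun i => X i ^+ 2 - e i ^+ 2)).
    by solve_tends.
  apply: filterS (filterI e_gt0 touch) => i [e0 [h _ _]].
  by rewrite /y expr_div_n h mulrC mulKf// expf_neq0// gt_eqF.
rewrite expr0n subr0 in y0E.
split.
  have lim : tends U
     (fun i => a i * (X i ^+ 2 + e i ^+ 2 * y i ^+ 2) + al i * X i + be i * (e i * y i) + p i)
     (0 * (X0 ^+ 2 + 0 ^+ 2 * y0 ^+ 2) + al0 * X0 + be0 * (0 * y0) + p0) by solve_tends.
  have <- : 0 * (X0 ^+ 2 + 0 ^+ 2 * y0 ^+ 2) + al0 * X0 + be0 * (0 * y0) + p0 = 0.
    apply: (tends_eq lim).
    apply: filterS (filterI e_gt0 touch) => i [e0 [_ h _]].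
    have e0' : e i != 0 by rewrite gt_eqF.
    by rewrite -h /y; field.
  by ring.
have lim : tends U
    (fun i => y i * (2 * a i * X i + al i) + e i * X i * (2 * a i * (e i * y i) + be i))
    (y0 * (2 * 0 * X0 + al0) + 0 * X0 * (2 * 0 * (0 * y0) + be0)) by solve_tends.
have : y0 * (2 * 0 * X0 + al0) + 0 * X0 * (2 * 0 * (0 * y0) + be0) = 0.
  apply: (tends_eq lim).
  apply: filterS (filterI e_gt0 touch) => i [e0 [_ _ h]].
  have e0' : e i != 0 by rewrite gt_eqF.
  by apply: (mulfI e0'); rewrite mulr0 -[RHS]h /y; field.
rewrite !(mulr0, mul0r) add0r addr0 => /eqP; rewrite mulf_eq0 => /orP[]/eqP h.
  by right; apply/eqP; rewrite -sqrf_eq0 -y0E h expr0n.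
by left.
Qed.

Section Far.
Hypothesis X_neq0 : \forall i \near U, X i != 0.
Hypothesis Xinv : tends U (fun i => (X i)^-1) 0.

Lemma far_slope : exists2 y0 : R, y0 ^+ 2 = 1 & tends U (fun i => Y i / X i / e i) y0.
Proof.
have [|y0 ycvg y0E] := @ultra_sqr_cvg _ _ _ ultraU (fun i => Y i / X i / e i) (1 - (0 * 0) ^+ 2).
  apply: (@tends_near _ _ _ _ _ (fun i => 1 - (e i * (X i)^-1) ^+ 2)).
    by solve_tends.
  apply: filterS (filterI (filterI e_gt0 X_neq0) touch) => i [[e0 x0] [h _ _]].
  have e0' : e i != 0 by rewrite gt_eqF.
  by rewrite !expr_div_n h; field; rewrite e0' x0.
by exists y0 => //; rewrite y0E mulr0 expr0n subr0.
Qed.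

Lemma far_direction : tends U (fun i => Y i / X i) 0.
Proof.
have [y0 _ ycvg] := far_slope.
apply: (@tends_near _ _ _ _ _ (fun i => e i * (Y i / X i / e i))).
  by rewrite -(mul0r y0); solve_tends.
apply: filterS e_gt0 => i e0.
by rewrite [RHS]mulrC divfK// gt_eqF.
Qed.

(** The tangency equation gives the limit [- al0 / 2] for [a * X], and the circle
    equation divided by [X] gives the limit [- al0]. *)
Lemma far_contact : al0 = 0.
Proof.
have [y0 y0E ycvg] := far_slope; have qcvg := far_direction.
have y00 : y0 != 0 by rewrite -sqrf_eq0 y0E oner_neq0.
pose y i := Y i / X i / e i; pose q i := Y i / X i.
change (tends U y y0) in ycvg; change (tends U q 0) in qcvg.
have den : \forall i \near U, 2 * (e i * q i + y i) != 0.
  apply: (@tends_neq0 _ _ _ _ _ (2 * (0 * 0 + y0))); first by solve_tends.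
  by rewrite mul0r add0r mulf_neq0// pnatr_eq0.
have Acvg : tends U (fun i => a i * X i) (- al0 / 2).
  have lim : tends U (fun i => - (y i * al i + e i * be i) / (2 * (e i * q i + y i)))
     (- (y0 * al0 + 0 * be0) / (2 * (0 * 0 + y0))).
    by solve_tends; rewrite mul0r add0r mulf_neq0// pnatr_eq0.
  have -> : - al0 / 2 = - (y0 * al0 + 0 * be0) / (2 * (0 * 0 + y0)) by field.
  apply: (tends_near lim).
  apply: filterS (filterI den (filterI (filterI e_gt0 X_neq0) touch)).
  move=> i [d [[e0 x0] [_ _ h]]].
  have e0' : e i != 0 by rewrite gt_eqF.
  apply: (canRL (mulfK d)).
  apply/eqP; rewrite -subr_eq0 opprK; apply/eqP.
  apply: (mulfI (mulf_neq0 e0' x0)); rewrite mulr0 -[RHS]h /y /q.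
  by field; rewrite e0' x0.
have lim : tends U
   (fun i => a i * X i + a i * X i * q i ^+ 2 + al i + be i * q i + p i * (X i)^-1)
   (- al0 / 2 + - al0 / 2 * 0 ^+ 2 + al0 + be0 * 0 + p0 * 0).
  by solve_tends.
have : - al0 / 2 + - al0 / 2 * 0 ^+ 2 + al0 + be0 * 0 + p0 * 0 = 0.
  apply: (tends_eq lim).
  apply: filterS (filterI X_neq0 touch) => i [x0 [_ h _]].
  by apply: (mulfI x0); rewrite mulr0 -[RHS]h /q; field.
lra.
Qed.

End Far.

(** A line at the limit is parallel to the axis, when the contact escapes along it,
    or passes through the origin. *)
Lemma contact_with_limit_line : al0 = 0 \/ p0 = 0.
Proof.
have [[X0 Xcvg]|[X_neq0 Xinv]] := ultra_dichotomy ultraU X.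
  have [circ [|X00]] := bounded_contact_limit Xcvg; first by left.
  by right; rewrite -circ X00 mulr0 add0r.
by left; exact: far_contact.
Qed.

(** When [p] tends to a nonzero limit and the other coefficients to 0, the circle
    leaves every bounded set.  At its own scale the hyperbola looks like a line
    through the origin, with the slope [q] of the contact tending to 0, and
    tangency with this line is the vanishing of a discriminant,
    [(al + be q)^2 = 4 a p].  Eliminating the linear terms between the circle
    equation and the tangency equation shows that [a * X^2] tends to [p0]. *)
Lemma contact_at_infinity : al0 = 0 -> p0 != 0 -> (\forall i \near U, 0 < a i) ->
  exists2 q : I -> R, tends U q 0 &
    tends U (fun i => (al i + be i * q i) ^+ 2 / a i) (4 * p0).
Proof.
move=> al00 p00 a_gt0.
have [[X0 Xcvg]|[X_neq0 Xinv]] := ultra_dichotomy ultraU X.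
  have [] := bounded_contact_limit Xcvg; rewrite al00 mul0r add0r => p0E.
  by rewrite p0E eqxx in p00.
have [y0 y0E ycvg] := far_slope X_neq0 Xinv; have qcvg := far_direction X_neq0 Xinv.
have y00 : y0 != 0 by rewrite -sqrf_eq0 y0E oner_neq0.
pose y i := Y i / X i / e i; pose q i := Y i / X i.
change (tends U y y0) in ycvg; change (tends U q 0) in qcvg.
have y_neq0 : \forall i \near U, y i != 0 by exact: tends_neq0 ycvg y00.
have Dcvg : tends U (fun i => 2 * e i ^+ 2 + 1 - e i ^+ 2 * y i ^+ 2)
    (2 * 0 ^+ 2 + 1 - 0 ^+ 2 * y0 ^+ 2) by solve_tends.
have Dlim : 2 * 0 ^+ 2 + 1 - 0 ^+ 2 * y0 ^+ 2 = 1 :> R by ring.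
rewrite Dlim in Dcvg.
have D_neq0 : \forall i \near U, 2 * e i ^+ 2 + 1 - e i ^+ 2 * y i ^+ 2 != 0.
  by exact: tends_neq0 Dcvg (oner_neq0 R).
have mcvg : tends U (fun i => a i * X i ^+ 2) p0.
  have lim : tends U (fun i => (p i - be i * (e i ^+ 3 * (y i)^-1 * (X i)^-1))
       / (2 * e i ^+ 2 + 1 - e i ^+ 2 * y i ^+ 2))
      ((p0 - be0 * (0 ^+ 3 * y0^-1 * 0)) / 1).
    by solve_tends; rewrite ?oner_neq0.
  have -> : p0 = (p0 - be0 * (0 ^+ 3 * y0^-1 * 0)) / 1 by field.
  apply: (tends_near lim).
  apply: filterS (filterI D_neq0 (filterI y_neq0 (filterI (filterI e_gt0 X_neq0) touch))).
  move=> i [d [yn0 [[e0 x0] [hQ hC hT]]]].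
  have e0' : e i != 0 by rewrite gt_eqF.
  apply: (canRL (mulfK d)).
  have YE : Y i = e i * y i * X i by rewrite /y; field; rewrite e0' x0.
  have yE : y i ^+ 2 = 1 - e i ^+ 2 / X i ^+ 2.
    by rewrite /y !expr_div_n hQ; field; rewrite e0' x0.
  have tangent : 2 * a i * e i ^+ 2 * X i ^+ 2 + be i * e i * X i / y i
      + 2 * a i * X i ^+ 2 + al i * X i = 0.
    apply: (mulfI (mulf_neq0 e0' yn0)); rewrite mulr0 -[RHS]hT YE.
    by field.
  have gap : e i * X i / y i - e i * y i * X i = e i ^+ 3 * (y i)^-1 * (X i)^-1.
    have -> : e i * X i / y i - e i * y i * X i = e i * X i / y i * (1 - y i ^+ 2) by field.
    by rewrite yE; field; rewrite x0 yn0.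
  rewrite -gap; rewrite YE in hC.
  have -> : a i * X i ^+ 2 * (2 * e i ^+ 2 + 1 - e i ^+ 2 * y i ^+ 2) =
    2 * a i * e i ^+ 2 * X i ^+ 2 + 2 * a i * X i ^+ 2
    - a i * (X i ^+ 2 + (e i * y i * X i) ^+ 2) by ring.
  lra.
exists q => //.
have lim : tends U
    (fun i => (a i * X i ^+ 2 * (1 + q i ^+ 2) + p i) ^+ 2 * (a i * X i ^+ 2)^-1)
    ((p0 * (1 + 0 ^+ 2) + p0) ^+ 2 * p0^-1) by solve_tends.
have -> : 4 * p0 = (p0 * (1 + 0 ^+ 2) + p0) ^+ 2 * p0^-1 by field.
apply: (tends_near lim).
apply: filterS (filterI a_gt0 (filterI X_neq0 touch)) => i [a0 [x0 [_ hC _]]].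
have a0' : a i != 0 by rewrite gt_eqF.
have YE : Y i = q i * X i by rewrite /q; field.
rewrite YE in hC.
have -> : a i * X i ^+ 2 * (1 + q i ^+ 2) + p i = - (al i + be i * q i) * X i by lra.
by field; rewrite a0' x0.
Qed.

End Infinity.

(** * Touching circles stay bounded *)

(** The line carries the axis of a hyperbola and the point its center.  The
    direction is meant to be a unit vector, which [generic_lines] requires. *)
Record pointed_line (R : realType) :=
  PointedLine { ptx : R; pty : R; dirx : R; diry : R }.

Definition idx0 : 'I_3 := Ordinal (isT : (0 < 3)%N).
Definition idx1 : 'I_3 := Ordinal (isT : (1 < 3)%N).
Definition idx2 : 'I_3 := Ordinal (isT : (2 < 3)%N).

Lemma idx_cases (Q : 'I_3 -> Prop) : Q idx0 -> Q idx1 -> Q idx2 -> forall i, Q i.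
Proof.
move=> Q0 Q1 Q2 [[|[|[|//]]] i3]; [move: Q0|move: Q1|move: Q2];
  by congr Q; exact: val_inj.
Qed.

Lemma det2_eq0 (R : realType) (a b c d x y : R) : a * d - b * c != 0 ->
  a * x + b * y = 0 -> c * x + d * y = 0 -> x = 0 /\ y = 0.
Proof.
move=> D h1 h2; split; apply: (mulfI D); rewrite mulr0.
  have -> : (a * d - b * c) * x = d * (a * x + b * y) - b * (c * x + d * y) by ring.
  by rewrite h1 h2 !mulr0 subr0.
have -> : (a * d - b * c) * y = a * (c * x + d * y) - c * (a * x + b * y) by ring.
by rewrite h1 h2 !mulr0 subr0.
Qed.

Section Frame.
Variable R : realType.
Implicit Types (f : pointed_line R) (a b c d : R).

(** Coefficients, in the orthonormal frame of the pointed line [f], of the curve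
    [a (x^2 + y^2) - 2 b x - 2 c y + d = 0].  For [a = 1] this is the circle
    with center [(b, c)] and [d = b^2 + c^2 - r^2]; these coordinates of a circle
    are used throughout, since the contact equations are affine in them. *)
Definition lin_along f a b c : R :=
  2 * (dirx f * (a * ptx f - b) + diry f * (a * pty f - c)).
Definition lin_across f a b c : R :=
  2 * (dirx f * (a * pty f - c) - diry f * (a * ptx f - b)).
Definition power f a b c d : R :=
  a * (ptx f ^+ 2 + pty f ^+ 2) - 2 * (ptx f * b + pty f * c) + d.

Definition cross x1 y1 x2 y2 : R := x1 * y2 - y1 * x2.

(** The positions that would allow touching circles to degenerate to a line are
    excluded: a line cannot have two of the directions, have one direction and
    pass through the other two points, or pass through all three points. *)
Record generic_lines (F : 'I_3 -> pointed_line R) : Prop := {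
  dir_unit : forall i, dirx (F i) ^+ 2 + diry (F i) ^+ 2 = 1;
  dir_indep : forall i j, i != j ->
    cross (dirx (F i)) (diry (F i)) (dirx (F j)) (diry (F j)) != 0;
  chord_indep : forall i j k, uniq [:: i; j; k] ->
    cross (dirx (F i)) (diry (F i)) (ptx (F j) - ptx (F k)) (pty (F j) - pty (F k)) != 0;
  points_indep :
    cross (ptx (F idx1) - ptx (F idx0)) (pty (F idx1) - pty (F idx0))
          (ptx (F idx2) - ptx (F idx0)) (pty (F idx2) - pty (F idx0)) != 0 }.

(** A circle of nonzero radius and center [w] cannot touch three distinct lines through
    the origin: the lines are at equal distance from [w] when the projections of
    [w] on them have equal length.  Write [x_i], [y_i] for the coordinates of the i-th direction relative to [w]:
    all [x_i^2] agree, hence all [y_i^2], so the products [x_i y_i] take at most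
    two opposite values; two of them agree, and then two of the directions are
    proportional. *)
Lemma no_three_equal_projections (F : 'I_3 -> pointed_line R) (w1 w2 d : R) :
  (forall i, dirx (F i) ^+ 2 + diry (F i) ^+ 2 = 1) ->
  (forall i j, i != j ->
    cross (dirx (F i)) (diry (F i)) (dirx (F j)) (diry (F j)) != 0) ->
  d != 0 -> ~ (forall i, (dirx (F i) * w1 + diry (F i) * w2) ^+ 2 = d).
Proof.
move=> unitF indepF d0 proj.
pose x i := dirx (F i) * w1 + diry (F i) * w2.
pose y i := dirx (F i) * w2 - diry (F i) * w1.
have xE i : x i ^+ 2 = d by exact: proj.
have yE i : y i ^+ 2 = w1 ^+ 2 + w2 ^+ 2 - d.
  rewrite -(xE i) /x /y -[w1 ^+ 2 + w2 ^+ 2]mul1r -(unitF i); ring.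
have w0 : w1 ^+ 2 + w2 ^+ 2 != 0.
  apply: contra d0 => /eqP w0; rewrite -(proj idx0).
  have -> : w1 = 0 by have := sqr_ge0 w1; have := sqr_ge0 w2; nra.
  have -> : w2 = 0 by have := sqr_ge0 w1; have := sqr_ge0 w2; nra.
  by rewrite !mulr0 addr0 expr0n.
have distinct i j : i != j -> x i * y i != x j * y j.
  move=> ij; apply/eqP => xy; have /negP := indepF _ _ ij; apply.
  rewrite -(mulIr_eq0 _ (mulIf w0)).
  have -> : cross (dirx (F i)) (diry (F i)) (dirx (F j)) (diry (F j)) *
    (w1 ^+ 2 + w2 ^+ 2) = x j * y i - x i * y j by rewrite /cross /x /y; ring.
  have xj0 : x j != 0 by rewrite -sqrf_eq0 xE.
  have [] : x i = x j \/ x i = - x j.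
    have /eqP : x i ^+ 2 = x j ^+ 2 by rewrite !xE.
    by rewrite eqf_sqr => /orP[] /eqP; [left|right].
    move=> xij; rewrite xij in xy *; have -> := mulfI xj0 xy.
    by apply/eqP; ring.
  move=> xij; rewrite xij in xy *.
  have -> : y j = - y i by apply: (mulfI xj0); rewrite -xy; ring.
  by apply/eqP; ring.
have sq i j : x i * y i = x j * y j \/ x i * y i = - (x j * y j).
  have /eqP : (x i * y i) ^+ 2 = (x j * y j) ^+ 2 by rewrite !exprMn !xE !yE.
  by rewrite eqf_sqr => /orP[] /eqP; [left|right].
have [/eqP|h1] := sq idx1 idx0; first exact/negP/distinct.
have [/eqP|h2] := sq idx2 idx0; first exact/negP/distinct.
by move: (distinct idx1 idx2 isT); rewrite h1 h2 eqxx.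
Qed.

End Frame.

Section Bounded.
Variable R : realType.
Variable F : 'I_3 -> pointed_line R.
Hypothesis genF : generic_lines F.
Variables (I : Type) (U : set_system I).
Hypothesis ultraU : UltraFilter U.
Variable e : I -> R.
Hypothesis e_gt0 : \forall i \near U, 0 < e i.
Hypothesis e_to0 : tends U e 0.

Section Homogeneous.
Variables (a b c d : I -> R) (X Y : 'I_3 -> I -> R).
Variables b0 c0 d0 : R.
Hypothesis a_gt0 : \forall i \near U, 0 < a i.
Hypothesis a_to0 : tends U a 0.
Hypothesis b_cvg : tends U b b0.
Hypothesis c_cvg : tends U c c0.
Hypothesis d_cvg : tends U d d0.
Let al k i := lin_along (F k) (a i) (b i) (c i).
Let be k i := lin_across (F k) (a i) (b i) (c i).
Let pw k i := power (F k) (a i) (b i) (c i) (d i).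
Hypothesis touch : forall k, \forall i \near U,
  touches (e i) (a i) (al k i) (be k i) (pw k i) (X k i) (Y k i).

Let al_cvg k : tends U (al k) (lin_along (F k) 0 b0 c0).
Proof. by rewrite /al /lin_along; solve_tends. Qed.

Let be_cvg k : tends U (be k) (lin_across (F k) 0 b0 c0).
Proof. by rewrite /be /lin_across; solve_tends. Qed.

Let pw_cvg k : tends U (pw k) (power (F k) 0 b0 c0 d0).
Proof. by rewrite /pw /power; solve_tends. Qed.

Let line_lim k : dirx (F k) * b0 + diry (F k) * c0 = 0 \/
  2 * (ptx (F k) * b0 + pty (F k) * c0) = d0.
Proof.
have := contact_with_limit_line ultraU e_gt0 e_to0 a_to0 (@al_cvg k) (@be_cvg k) (@pw_cvg k) (@touch k).
by rewrite /lin_along /power => -[h|h]; [left|right]; lra.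
Qed.

(** One case for each choice, per side, between parallelism and incidence; each leaves
    a nondegenerate linear system for the normal vector of the limit line. *)
Lemma no_line_at_limit : b0 = 0 /\ c0 = 0.
Proof.
have dd i j : i != j -> dirx (F i) * b0 + diry (F i) * c0 = 0 ->
    dirx (F j) * b0 + diry (F j) * c0 = 0 -> b0 = 0 /\ c0 = 0.
  by move=> ij; exact: det2_eq0 (dir_indep genF ij).
have dp i j k : uniq [:: i; j; k] -> dirx (F i) * b0 + diry (F i) * c0 = 0 ->
    2 * (ptx (F j) * b0 + pty (F j) * c0) = d0 ->
    2 * (ptx (F k) * b0 + pty (F k) * c0) = d0 -> b0 = 0 /\ c0 = 0.
  move=> ijk di pj pk; apply: det2_eq0 (chord_indep genF ijk) di _; lra.
have [d0'|p0'] := line_lim idx0; have [d1|p1] := line_lim idx1;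
  have [d2|p2] := line_lim idx2.
- exact: (dd idx0 idx1).
- exact: (dd idx0 idx1).
- exact: (dd idx0 idx2).
- exact: (dp idx0 idx1 idx2).
- exact: (dd idx1 idx2).
- exact: (dp idx1 idx0 idx2).
- exact: (dp idx2 idx0 idx1).
- by apply: det2_eq0 (points_indep genF) _ _; lra.
Qed.

(** With the rescaling [w = (b, c) / sqrt a], the conditions of
    [contact_at_infinity] say that in the limit the three directions have
    projections of equal nonzero square on [w].  Convergence of [w] itself comes
    from solving the first two of them, whose directions are independent. *)
Lemma no_point_at_limit : d0 = 0.
Proof.
have [b00 c00] := no_line_at_limit.
apply/eqP/negPn/negP => d00.
have pl k : exists2 q : I -> R, tends U q 0 &
    tends U (fun i => (al k i + be k i * q i) ^+ 2 / a i) (4 * d0).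
  have pE : power (F k) 0 b0 c0 d0 = d0 by rewrite /power b00 c00; ring.
  have := contact_at_infinity ultraU e_gt0 e_to0 a_to0 (@al_cvg k) (@be_cvg k)
    (@pw_cvg k) (@touch k); rewrite pE; apply => //.
  by rewrite /lin_along b00 c00; ring.
have [q q0 qcvg] : exists2 q : 'I_3 -> I -> R, forall k, tends U (q k) 0 &
    forall k, tends U (fun i => (al k i + be k i * q k i) ^+ 2 / a i) (4 * d0).
  have [q qP] := @choice _ _ (fun k q => tends U q 0 /\
     tends U (fun i => (al k i + be k i * q i) ^+ 2 / a i) (4 * d0))
     (fun k => let: ex_intro2 q h1 h2 := pl k in ex_intro _ q (conj h1 h2)).
  by exists q => k; have [] := qP k.
pose r i := Num.sqrt (a i).
have r_gt0 : \forall i \near U, 0 < r i.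
  by apply: filterS a_gt0 => i; rewrite sqrtr_gt0.
have r2 : \forall i \near U, r i ^+ 2 = a i.
  by apply: filterS a_gt0 => i a0; rewrite sqr_sqrtr// ltW.
have r_cvg : tends U r 0.
  have [r0 rr0 r0E] : exists2 r0 : R, tends U r r0 & r0 ^+ 2 = 0.
    by apply: (ultra_sqr_cvg ultraU); apply: tends_near a_to0 r2.
  by have /eqP := r0E; rewrite sqrf_eq0 => /eqP <-.
have xl k : exists2 x : R, tends U (fun i => (al k i + be k i * q k i) / r i) x &
    x ^+ 2 = 4 * d0.
  apply: (ultra_sqr_cvg ultraU); apply: (tends_near (qcvg k)).
  by apply: filterS r2 => i <-; rewrite expr_div_n.
have [x xcvg xE] : exists2 x : 'I_3 -> R,
    forall k, tends U (fun i => (al k i + be k i * q k i) / r i) (x k) &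
    forall k, x k ^+ 2 = 4 * d0.
  have [x xP] := @choice _ _ (fun k x =>
     tends U (fun i => (al k i + be k i * q k i) / r i) x /\ x ^+ 2 = 4 * d0)
     (fun k => let: ex_intro2 x h1 h2 := xl k in ex_intro _ x (conj h1 h2)).
  by exists x => k; have [] := xP k.
pose f1 k i := dirx (F k) - diry (F k) * q k i.
pose f2 k i := diry (F k) + dirx (F k) * q k i.
have f1_cvg k : tends U (f1 k) (dirx (F k)).
  by rewrite -[X in tends _ _ X]subr0 -(mulr0 (diry (F k))) /f1; solve_tends.
have f2_cvg k : tends U (f2 k) (diry (F k)).
  by rewrite -[X in tends _ _ X]addr0 -(mulr0 (dirx (F k))) /f2; solve_tends.
pose z k i := f1 k i * (b i / r i) + f2 k i * (c i / r i).
have zcvg k : tends U (z k) (- (x k / 2)).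
  have xk := xcvg k.
  have lim : tends U (fun i => r i * (f1 k i * ptx (F k) + f2 k i * pty (F k))
      - (al k i + be k i * q k i) / r i / 2)
      (0 * (dirx (F k) * ptx (F k) + diry (F k) * pty (F k)) - x k / 2).
    by solve_tends.
  have -> : - (x k / 2) = 0 * (dirx (F k) * ptx (F k) + diry (F k) * pty (F k)) - x k / 2.
    by ring.
  apply: (tends_near lim); apply: filterS (filterI r_gt0 r2) => i [r0 r2i].
  have r0' : r i != 0 by rewrite gt_eqF.
  rewrite /z /f1 /f2 /al /be /lin_along /lin_across -r2i; field.
  by [].
have D0 := dir_indep genF (isT : idx0 != idx1).
pose D i := f1 idx0 i * f2 idx1 i - f2 idx0 i * f1 idx1 i.
have D_cvg : tends U D (cross (dirx (F idx0)) (diry (F idx0)) (dirx (F idx1)) (diry (F idx1))).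
  by rewrite /cross /D; solve_tends.
have D_neq0 : \forall i \near U, D i != 0 by exact: tends_neq0 D_cvg D0.
have [w1 w1_cvg] : exists w : R, tends U (fun i => b i / r i) w.
  exists (((- (x idx0 / 2)) * diry (F idx1) - diry (F idx0) * - (x idx1 / 2)) /
    cross (dirx (F idx0)) (diry (F idx0)) (dirx (F idx1)) (diry (F idx1))).
  have lim : tends U (fun i => (z idx0 i * f2 idx1 i - f2 idx0 i * z idx1 i) / D i)
   (((- (x idx0 / 2)) * diry (F idx1) - diry (F idx0) * - (x idx1 / 2)) /
    cross (dirx (F idx0)) (diry (F idx0)) (dirx (F idx1)) (diry (F idx1))).
    by solve_tends.
  apply: (tends_near lim); apply: filterS D_neq0 => i Di.
  by apply: (canRL (mulfK Di)); rewrite /z /D; ring.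
have [w2 w2_cvg] : exists w : R, tends U (fun i => c i / r i) w.
  exists ((dirx (F idx0) * - (x idx1 / 2) - (- (x idx0 / 2)) * dirx (F idx1)) /
    cross (dirx (F idx0)) (diry (F idx0)) (dirx (F idx1)) (diry (F idx1))).
  have lim : tends U (fun i => (f1 idx0 i * z idx1 i - z idx0 i * f1 idx1 i) / D i)
   ((dirx (F idx0) * - (x idx1 / 2) - (- (x idx0 / 2)) * dirx (F idx1)) /
    cross (dirx (F idx0)) (diry (F idx0)) (dirx (F idx1)) (diry (F idx1))).
    by solve_tends.
  apply: (tends_near lim); apply: filterS D_neq0 => i Di.
  by apply: (canRL (mulfK Di)); rewrite /z /D; ring.
apply: (@no_three_equal_projections _ F w1 w2 d0 (dir_unit genF) (dir_indep genF) d00) => k.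
have -> : dirx (F k) * w1 + diry (F k) * w2 = - (x k / 2).
  have lim : tends U (z k) (dirx (F k) * w1 + diry (F k) * w2) by rewrite /z; solve_tends.
  by apply: tends_unique lim (zcvg k) _; exact: nearW.
by rewrite sqrrN expr_div_n xE; field.
Qed.

End Homogeneous.

(** The coefficients are normalised to absolute sum 1, so they converge, and not to 0;
    the previous two lemmas leave only a nonzero limit of the leading one. *)
Lemma touching_circles_bounded (s t g : I -> R) (X Y : 'I_3 -> I -> R) :
  (forall k, \forall i \near U,
    touches (e i) 1 (lin_along (F k) 1 (s i) (t i)) (lin_across (F k) 1 (s i) (t i))
      (power (F k) 1 (s i) (t i) (g i)) (X k i) (Y k i)) ->
  exists s0 t0 g0 : R, [/\ tends U s s0, tends U t t0 & tends U g g0].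
Proof.
move=> touch.
pose M i := 1 + `|s i| + `|t i| + `|g i|.
have M_gt0 i : 0 < M i.
  by rewrite /M; have := normr_ge0 (s i); have := normr_ge0 (t i); have := normr_ge0 (g i); lra.
pose a i := (M i)^-1; pose b i := s i * a i; pose c i := t i * a i; pose d i := g i * a i.
have a_gt0 i : 0 < a i by rewrite invr_gt0.
have sum1 i : a i + `|b i| + `|c i| + `|d i| = 1.
  rewrite /b /c /d !normrM (gtr0_norm (a_gt0 i)) /a.
  apply: (mulIf (lt0r_neq0 (M_gt0 i))); rewrite !mulrDl mul1r !divfK ?mulVf// ?lt0r_neq0//.
have le1 i : [/\ `|a i| <= 1, `|b i| <= 1, `|c i| <= 1 & `|d i| <= 1].
  have := sum1 i; have := normr_ge0 (b i); have := normr_ge0 (c i).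
  have := normr_ge0 (d i); have := a_gt0 i; rewrite (gtr0_norm (a_gt0 i)) => *.
  by split; lra.
have [a0 a_cvg] : exists a0 : R, tends U a a0.
  by apply: (@ultra_bounded_cvg _ _ _ ultraU _ 1); apply: nearW => i; have [] := le1 i.
have [b0 b_cvg] : exists b0 : R, tends U b b0.
  by apply: (@ultra_bounded_cvg _ _ _ ultraU _ 1); apply: nearW => i; have [] := le1 i.
have [c0 c_cvg] : exists c0 : R, tends U c c0.
  by apply: (@ultra_bounded_cvg _ _ _ ultraU _ 1); apply: nearW => i; have [] := le1 i.
have [d0 d_cvg] : exists d0 : R, tends U d d0.
  by apply: (@ultra_bounded_cvg _ _ _ ultraU _ 1); apply: nearW => i; have [] := le1 i.
have a_neq0 i : a i != 0 by rewrite lt0r_neq0.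
have [a00|a00] := eqVneq a0 0; last first.
  exists (b0 / a0), (c0 / a0), (d0 / a0); split.
  - apply: (@tends_near _ _ _ _ _ (fun i => b i / a i)); first by solve_tends.
    by apply: nearW => i; rewrite /b mulfK.
  - apply: (@tends_near _ _ _ _ _ (fun i => c i / a i)); first by solve_tends.
    by apply: nearW => i; rewrite /c mulfK.
  - apply: (@tends_near _ _ _ _ _ (fun i => d i / a i)); first by solve_tends.
    by apply: nearW => i; rewrite /d mulfK.
exfalso; rewrite a00 in a_cvg.
have touch' k : \forall i \near U,
    touches (e i) (a i) (lin_along (F k) (a i) (b i) (c i))
      (lin_across (F k) (a i) (b i) (c i))
      (power (F k) (a i) (b i) (c i) (d i)) (X k i) (Y k i).
  apply: filterS (touch k) => i [hQ hC hT]; split => //.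
    by rewrite -[RHS](mulr0 (a i)) -hC /lin_along /lin_across /power /b /c /d; ring.
  by rewrite -[RHS](mulr0 (a i)) -hT /lin_along /lin_across /power /b /c /d; ring.
have a_near : \forall i \near U, 0 < a i by apply: nearW.
have [b00 c00] := no_line_at_limit a_cvg b_cvg c_cvg d_cvg touch'.
have d00 := no_point_at_limit a_near a_cvg b_cvg c_cvg d_cvg touch'.
have lim : tends U (fun i => a i + `|b i| + `|c i| + `|d i|) (0 + `|b0| + `|c0| + `|d0|).
  by do 3?[apply: tendsD => //]; exact: tends_norm.
have : 0 + `|b0| + `|c0| + `|d0| = 1 by apply: tends_eq lim _; exact: nearW.
by rewrite b00 c00 d00 normr0 !addr0 => /eqP; rewrite eq_sym oner_eq0.
Qed.

End Bounded.

(** * Persistence of regular zeros *)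

(** Makes real matrices a complete normed module, as the fixed point theorem needs. *)
HB.instance Definition _ (R : realType) m n :=
  Uniform_isComplete.Build 'M[R]_(m, n) cauchy_cvg.

Section RegularZero.
Variables (R : realType) (V : completeNormedModType R).
Variables (f : R -> V -> V) (x0 : V) (D : V -> V) (Dinv : {additive V -> V}) (K : R).
Hypothesis K_gt0 : 0 < K.
Hypothesis Dinv_bounded : forall h, `|Dinv h| <= K * `|h|.
Hypothesis DK : forall h, Dinv (D h) = h.
Hypothesis Dinv_inj : injective Dinv.
Hypothesis strict : forall eta, 0 < eta -> exists2 delta, 0 < delta &
  forall e x y, 0 < e < delta -> `|x - x0| < delta -> `|y - x0| < delta ->
    `|f e x - f e y - D (x - y)| <= eta * `|x - y|.
Hypothesis f_to0 : f e x0 @[e --> 0^'+] --> (0 : V).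

(** The simplified Newton map, with the derivative frozen at the limit zero. *)
Let T e x := x - Dinv (f e x).

Let T_fixed e x : T e x = x <-> f e x = 0.
Proof.
split=> [Tx|fx]; last by rewrite /T fx raddf0 subr0.
by apply: Dinv_inj; rewrite raddf0 -[LHS](subKr x) -/(T e x) Tx subrr.
Qed.

Let T_contracts : exists2 rho, 0 < rho & exists2 delta, 0 < delta &
  forall e x y, 0 < e < delta -> `|x - x0| <= rho -> `|y - x0| <= rho ->
    `|T e x - T e y| <= 2^-1 * `|x - y|.
Proof.
have [|d d0 dP] := strict (eta := (2 * K)^-1); first by rewrite invr_gt0 mulr_gt0.
exists (d / 2); first by rewrite divr_gt0.
exists d => // e x y ed xd yd.
have dd : d / 2 < d by lra.
have := dP e x y ed (le_lt_trans xd dd) (le_lt_trans yd dd).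
have -> : T e x - T e y = - Dinv (f e x - f e y - D (x - y)).
  by rewrite !(raddfB Dinv) DK /T [RHS]opprB !opprD !opprK addrACA.
move=> h; rewrite normrN; apply: le_trans (Dinv_bounded _) _.
apply: le_trans (ler_wpM2l (ltW K_gt0) h) _.
by rewrite mulrA; apply: ler_wpM2r => //; rewrite invfM mulrCA mulfV ?mulr1// gt_eqF.
Qed.

(** Strict differentiability at [x0], uniform in [e > 0], makes the simplified Newton
    map contract a ball whose radius does not depend on [e].  Its fixed point
    converges to [x0], since their distance is at most twice the displacement
    of [x0] by the map. *)
Lemma regular_zero_persists : exists2 rho, 0 < rho &
  exists2 phi : R -> V, phi @ 0^'+ --> x0 &
  \forall e \near 0^'+, f e (phi e) = 0 /\
    forall x, `|x - x0| <= rho -> f e x = 0 -> x = phi e.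
Proof.
have [rho rho0 [delta delta0 contr]] := T_contracts.
have small : \forall e \near 0^'+, 0 < e < delta /\ K * `|f e x0| <= rho / 2.
  near=> e; split; first by apply/andP; split; near: e; [exact: nbhs_right_gt|exact: nbhs_right_lt].
  have : `|f e x0| <= rho / 2 / K.
    near: e; have /cvgrPdist_le := f_to0; move/(_ (rho / 2 / K)).
    rewrite !divr_gt0// => /(_ isT); apply: filterS => e.
    by rewrite sub0r normrN.
  by rewrite ler_pdivlMr// mulrC.
have zeros e : exists p, (0 < e < delta /\ K * `|f e x0| <= rho / 2) ->
    f e p = 0 /\ `|p - x0| <= 2 * (K * `|f e x0|).
  have [[ed fe]|ne] := pselect (0 < e < delta /\ K * `|f e x0| <= rho / 2); last first.
    by exists x0.
  pose B := closed_ball_ (fun x : V => `|x|) x0 rho.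
  have BE x : B x = (`|x - x0| <= rho) by rewrite /B /closed_ball_ /= distrC.
  have Bx0 : B x0 by rewrite BE subrr normr0 ltW.
  have Tx0 : `|T e x0 - x0| <= K * `|f e x0|.
    by rewrite /T addrAC subrr sub0r normrN.
  have TB : {homo T e : x / B x >-> B x}.
    move=> x; rewrite !BE => xB.
    have -> : T e x - x0 = T e x - T e x0 + (T e x0 - x0) by rewrite subrKA.
    apply: le_trans (ler_normD _ _) _.
    have := contr e x x0 ed xB; rewrite subrr normr0 => /(_ (ltW rho0)); lra.
  pose fT := mkfun_fun TB.
  have ctr : is_contraction fT.
    exists (2^-1)%:nng; split => /=; first by rewrite invf_lt1// ltr1n.
    by move=> [x y] [/= Bx By]; apply: contr; rewrite -?BE.
  have [|p Bp pE] := banach_fixed_point ctr _ (ex_intro _ x0 Bx0).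
    exact: closed_closed_ball_.
  exists p => _; rewrite BE in Bp.
  have Tp : T e p = p by rewrite [RHS]pE.
  split; first exact/T_fixed.
  have := contr e p x0 ed Bp; rewrite subrr normr0 => /(_ (ltW rho0)).
  rewrite Tp => h.
  have : `|p - x0| <= `|p - T e x0| + `|T e x0 - x0| by exact: ler_distD.
  lra.
have [phi phiP] := choice zeros.
exists rho => //; exists phi.
  apply/cvgrPdist_le => eta eta0; near=> e.
  have [|_ phie] := phiP e; first by near: e.
  rewrite distrC (le_trans phie)//.
  have : `|f e x0| <= eta / 2 / K.
    near: e; have /cvgrPdist_le := f_to0; move/(_ (eta / 2 / K)).
    rewrite !divr_gt0// => /(_ isT); apply: filterS => e.
    by rewrite sub0r normrN.
  by rewrite ler_pdivlMr//; lra.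
apply: filterS small => e sm; have [phi0 phie] := phiP e sm.
split => // x xrho fx; case: sm => ed fe.
have phirho : `|phi e - x0| <= rho by lra.
have := contr e x (phi e) ed xrho phirho.
have [-> ->] : T e x = x /\ T e (phi e) = phi e by split; apply/T_fixed.
have := normr_ge0 (x - phi e) => ? ?.
by apply/eqP; rewrite -subr_eq0 -normr_eq0; apply/eqP; lra.
Unshelve. all: by end_near. Qed.

End RegularZero.

Lemma entry_le_norm (R : realType) m n (h : 'M[R]_(m, n)) i j : `|h i j| <= `|h|.
Proof.
have -> : `|h| = matrix_normedtype.mx_norm h by [].
rewrite mx_normrE.
exact: (le_bigmax _ (fun ij : 'I_m * 'I_n => `|h ij.1 ij.2|) (i, j)).
Qed.

Lemma linear_bijection_bounded_inverse (R : realType) m n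
    (D : 'M[R]_(m, n) -> 'M[R]_(m, n)) :
  linear D -> (forall h, D h = 0 -> h = 0) ->
  exists (Dinv : {additive 'M[R]_(m, n) -> 'M[R]_(m, n)}) (K : R),
    [/\ 0 < K, forall h, `|Dinv h| <= K * `|h|, forall h, Dinv (D h) = h &
        injective Dinv].
Proof.
move=> linD kerD.
pose Dlin : {linear 'M[R]_(m, n) -> 'M[R]_(m, n)} :=
  HB.pack D (GRing.isLinear.Build R _ _ _ D linD).
have kerL : lker (linfun Dlin) == 0%VS.
  apply/lker0P => x y; rewrite !lfunE /= => xy.
  apply/eqP; rewrite -subr_eq0; apply/eqP/kerD.
  by rewrite -[D _]/(Dlin _) raddfB /= xy subrr.
pose Dinv : {linear 'M[R]_(m, n) -> 'M[R]_(m, n)} := ((linfun Dlin)^-1)%VF.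
have bound h : `|Dinv h| <= (\sum_(i < m) \sum_(j < n) `|Dinv (delta_mx i j)|) * `|h|.
  rewrite [X in Dinv X]matrix_sum_delta (linear_sum Dinv).
  apply: le_trans (ler_norm_sum _ _ _) _; rewrite mulr_suml; apply: ler_sum => i _.
  rewrite (linear_sum Dinv).
  apply: le_trans (ler_norm_sum _ _ _) _; rewrite mulr_suml; apply: ler_sum => j _.
  by rewrite linearZ normrZ mulrC ler_wpM2l// entry_le_norm.
exists Dinv, (\sum_(i < m) \sum_(j < n) `|Dinv (delta_mx i j)| + 1); split.
- by rewrite ltr_wpDl// sumr_ge0// => i _; rewrite sumr_ge0.
- by move=> h; rewrite mulrDl mul1r; apply: ler_wpDr => //; exact: bound.
- by move=> h; have := lker0_lfunK kerL h; rewrite lfunE.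
- by apply: can_inj; exact: lker0_lfunVK kerL.
Qed.

Lemma norm_le_entries (R : realType) m n (h : 'M[R]_(m, n)) (M : R) :
  0 <= M -> (forall i j, `|h i j| <= M) -> `|h| <= M.
Proof.
move=> M0 hM; have -> : `|h| = matrix_normedtype.mx_norm h by [].
by rewrite mx_normrE; apply/bigmax_leP; split.
Qed.

Section StrictDerivative.
Variables (R : realType) (m n : nat).
Local Notation V := 'M[R]_(m, n).
Variable x0 : V.

(** Triples made of a parameter tending to 0 from the right and of two points
    tending to [x0]. *)
Definition near_pairs : set_system (R * V * V) :=
  filter_prod (filter_prod 0^'+ (nbhs x0)) (nbhs x0).

Instance near_pairs_proper : ProperFilter near_pairs.
Proof. exact: filter_prod_proper. Qed.

Lemma near_pairs_param : (fun p : R * V * V => p.1.1) @ near_pairs --> 0^'+.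
Proof. exact: (@cvg_comp _ _ _ (@fst (R * V) V) (@fst R V) _ _ _ cvg_fst cvg_fst). Qed.

Lemma near_pairs_left : (fun p : R * V * V => p.1.2) @ near_pairs --> x0.
Proof. exact: (@cvg_comp _ _ _ (@fst (R * V) V) (@snd R V) _ _ _ cvg_fst cvg_snd). Qed.

Definition dot (d h : V) : R := \sum_i \sum_j d i j * h i j.

Lemma dotDl d1 d2 h : dot (d1 + d2) h = dot d1 h + dot d2 h.
Proof.
rewrite /dot -big_split; apply: eq_bigr => i _.
by rewrite -big_split; apply: eq_bigr => j _; rewrite mxE mulrDl.
Qed.

Lemma dotZl c d h : dot (c *: d) h = c * dot d h.
Proof.
rewrite /dot mulr_sumr; apply: eq_bigr => i _.
by rewrite mulr_sumr; apply: eq_bigr => j _; rewrite mxE mulrA.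
Qed.

Lemma dot0l h : dot 0 h = 0.
Proof. by rewrite -(scale0r 0) dotZl mul0r. Qed.

Lemma dotNl d h : dot (- d) h = - dot d h.
Proof. by rewrite -scaleN1r dotZl mulN1r. Qed.

Lemma dot_delta i j h : dot (delta_mx i j) h = h i j.
Proof.
rewrite /dot (bigD1 i)//= (bigD1 j)//= mxE !eqxx mul1r.
rewrite big1 ?addr0 => [|j' jj']; last by rewrite mxE (negPf jj') andbF mul0r.
by rewrite big1 ?addr0 // => i' ii'; apply: big1 => j' _; rewrite mxE (negPf ii') mul0r.
Qed.

Lemma dot_linear d c h1 h2 : dot d (c *: h1 + h2) = c * dot d h1 + dot d h2.
Proof.
rewrite /dot mulr_sumr -big_split; apply: eq_bigr => i _.
rewrite mulr_sumr -big_split; apply: eq_bigr => j _.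
by rewrite !mxE mulrDr mulrCA.
Qed.

(** Strict differentiability in Hadamard form: the increment between two points is an
    exact scalar product with a vector [a] converging to the derivative [d].
    This form is stable under sums and products by algebra alone, and it bounds
    the remainder by the sup norm. *)
Definition strict_diff (g : R -> V -> R) (v : R) (d : V) : Prop :=
  [/\ tends near_pairs (fun p => g p.1.1 p.1.2) v,
      tends near_pairs (fun p => g p.1.1 p.2) v &
      exists2 a : R * V * V -> V,
        forall p, g p.1.1 p.1.2 - g p.1.1 p.2 = dot (a p) (p.1.2 - p.2) &
        forall i j, tends near_pairs (fun p => a p i j) (d i j)].

Lemma strict_diff_param (c : R -> R) (c0 : R) :
  tends 0^'+ c c0 -> strict_diff (fun e _ => c e) c0 0.
Proof.
move=> cc0; have lim : tends near_pairs (fun p => c p.1.1) c0.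
  apply: (@cvg_comp _ _ _ (fun p : R * V * V => p.1.1) c _ _ _ near_pairs_param cc0).
split => //; exists (fun=> 0); first by move=> p; rewrite subrr dot0l.
by move=> i j; rewrite mxE; exact: tends_cst.
Qed.

Lemma strict_diff_coord i j : strict_diff (fun _ x => x i j) (x0 i j) (delta_mx i j).
Proof.
have cont : (fun x : V => x i j) @ x0 --> x0 i j by exact: coord_continuous.
split.
- apply: (cvg_comp _ _ _ cont).
  exact: (cvg_comp (@fst _ _) (@snd _ _) cvg_fst cvg_snd).
- by apply: (cvg_comp _ _ _ cont); exact: cvg_snd.
- exists (fun=> delta_mx i j); first by move=> p; rewrite dot_delta !mxE.
  by move=> k l; exact: tends_cst.
Qed.

Lemma strict_diffD g1 g2 v1 v2 d1 d2 :
  strict_diff g1 v1 d1 -> strict_diff g2 v2 d2 ->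
  strict_diff (fun e x => g1 e x + g2 e x) (v1 + v2) (d1 + d2).
Proof.
move=> [x1 y1 [a1 a1E a1l]] [x2 y2 [a2 a2E a2l]]; split; try exact: tendsD.
exists (fun p => a1 p + a2 p).
  by move=> p; rewrite dotDl -a1E -a2E; ring.
by move=> i j; rewrite mxE; under eq_fun do rewrite mxE; exact: tendsD.
Qed.

Lemma strict_diffN g v d :
  strict_diff g v d -> strict_diff (fun e x => - g e x) (- v) (- d).
Proof.
move=> [x1 y1 [a1 a1E a1l]]; split; try exact: tendsN.
exists (fun p => - a1 p).
  by move=> p; rewrite dotNl -a1E; ring.
by move=> i j; rewrite mxE; under eq_fun do rewrite mxE; exact: tendsN.
Qed.

Lemma strict_diffM g1 g2 v1 v2 d1 d2 :
  strict_diff g1 v1 d1 -> strict_diff g2 v2 d2 ->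
  strict_diff (fun e x => g1 e x * g2 e x) (v1 * v2) (v1 *: d2 + v2 *: d1).
Proof.
move=> [x1 y1 [a1 a1E a1l]] [x2 y2 [a2 a2E a2l]]; split; try exact: tendsM.
exists (fun p => g1 p.1.1 p.1.2 *: a2 p + g2 p.1.1 p.2 *: a1 p).
  by move=> p; rewrite dotDl !dotZl -a1E -a2E; ring.
by move=> i j; rewrite !mxE; under eq_fun do rewrite !mxE; apply: tendsD; exact: tendsM.
Qed.

Lemma strict_diff_slice g v d :
  strict_diff g v d -> tends 0^'+ (fun e => g e x0) v.
Proof.
move=> [gx _ _].
have diag : (fun e : R => (e, x0, x0)) @ 0^'+ --> near_pairs.
  rewrite /near_pairs => A [[B C] /= [[[P Q] /= [FP FQ] PQ] FC] BC].
  apply: filterS FP => e Pe; apply: (BC (e, x0, x0)); split => /=.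
    by apply: (PQ (e, x0)); split => //=; exact: nbhs_singleton.
  exact: nbhs_singleton.
exact: (@cvg_comp _ _ _ (fun e : R => (e, x0, x0)) (fun p : R * V * V => g p.1.1 p.1.2)
  _ _ _ diag gx).
Qed.

Section System.
Variables (G : R -> V -> V) (d : 'I_m -> 'I_n -> V).
Hypothesis Gd : forall i j, strict_diff (fun e x => G e x i j) 0 (d i j).

Lemma strict_diff_system eta : 0 < eta -> exists2 delta, 0 < delta &
  forall e x y, 0 < e < delta -> `|x - x0| < delta -> `|y - x0| < delta ->
    `|G e x - G e y - \matrix_(i, j) dot (d i j) (x - y)| <= eta * `|x - y|.
Proof.
move=> eta0.
have [a aE al] : exists2 a : 'I_m -> 'I_n -> R * V * V -> V,
    forall i j p, G p.1.1 p.1.2 i j - G p.1.1 p.2 i j = dot (a i j p) (p.1.2 - p.2) &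
    forall i j k l, tends near_pairs (fun p => a i j p k l) (d i j k l).
  have /choice [a aP] : forall ij : 'I_m * 'I_n, exists a : R * V * V -> V,
      (forall p, G p.1.1 p.1.2 ij.1 ij.2 - G p.1.1 p.2 ij.1 ij.2 = dot (a p) (p.1.2 - p.2)) /\
      forall k l, tends near_pairs (fun p => a p k l) (d ij.1 ij.2 k l).
    by move=> [i j]; have [_ _ [a ? ?]] := Gd i j; exists a.
  by exists (fun i j => a (i, j)) => i j; have [] := aP (i, j).
pose c := eta / (m * n).+1%:R.
have c0 : 0 < c by rewrite divr_gt0.
have small : \forall p \near near_pairs, forall i j k l, `|d i j k l - a i j p k l| <= c.
  apply: filter_forall => i; apply: filter_forall => j.
  apply: filter_forall => k; apply: filter_forall => l.
  by have /cvgrPdist_le := al i j k l; exact.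
have [[S1 S2] /= [[[S3 S4] /= [S3n S4n] S34] S2n] S12] := small.
have [r1 /= r1_gt0 r1P] := S3n.
have /nbhs_ballP [r2 /= r2_gt0 r2P] := S4n.
have /nbhs_ballP [r3 /= r3_gt0 r3P] := S2n.
exists (Order.min r1 (Order.min r2 r3)); first by rewrite !lt_min r1_gt0 r2_gt0.
move=> e x y /andP[e0]; rewrite !lt_min => /and3P[e1 _ _] /and3P[_ x2 _] /and3P[_ _ y3].
have {}small : forall i j k l, `|d i j k l - a i j (e, x, y) k l| <= c.
  apply: (S12 (e, x, y)); split => /=.
    apply: (S34 (e, x)); split => /=.
      by apply: r1P => //=; rewrite sub0r normrN gtr0_norm.
    by apply: r2P; rewrite -ball_normE /= distrC.
  by apply: r3P; rewrite -ball_normE /= distrC.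
apply: norm_le_entries => [|i j]; first by rewrite mulr_ge0// ltW.
rewrite !mxE (aE i j (e, x, y)) /= /dot -sumrB.
apply: le_trans (ler_norm_sum _ _ _) _.
apply: (@le_trans _ _ (\sum_(k < m) \sum_(l < n) c * `|x - y|)).
  apply: ler_sum => k _; rewrite -sumrB.
  apply: le_trans (ler_norm_sum _ _ _) _; apply: ler_sum => l _.
  rewrite -mulrBl normrM ler_pM// ?entry_le_norm//.
  by rewrite distrC; exact: small.
rewrite !sumr_const !card_ord -mulrnA -mulr_natr mulrAC ler_wpM2r//.
by rewrite /c mulrAC ler_pdivrMr// ler_pM2l// ler_nat mulnC ltnW.
Qed.

Lemma system_to0 : G e x0 @[e --> 0^'+] --> (0 : V).
Proof.
apply/cvgrPdist_le => eta eta0.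
have small : \forall e \near 0^'+, forall i j, `|0 - G e x0 i j| <= eta.
  apply: filter_forall => i; apply: filter_forall => j.
  by have /cvgrPdist_le := strict_diff_slice (Gd i j); exact.
apply: filterS small => e small; apply: norm_le_entries => [|i j]; first exact: ltW.
by have := small i j; rewrite !mxE.
Qed.

Lemma system_zero_persists :
  (forall h, (forall i j, dot (d i j) h = 0) -> h = 0) ->
  exists2 rho, 0 < rho & exists2 phi : R -> V, phi @ 0^'+ --> x0 &
  \forall e \near 0^'+, G e (phi e) = 0 /\
    forall x, `|x - x0| <= rho -> G e x = 0 -> x = phi e.
Proof.
move=> ker.
pose D (h : V) : V := \matrix_(i, j) dot (d i j) h.
have linD : linear D by move=> c h1 h2; apply/matrixP => i j; rewrite !mxE dot_linear.
have [|Dinv [K [K0 DinvB DK Dinj]]] := linear_bijection_bounded_inverse linD.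
  by move=> h /matrixP Dh; apply: ker => i j; have := Dh i j; rewrite !mxE.
exact: (regular_zero_persists K0 DinvB DK Dinj strict_diff_system system_to0).
Qed.

End System.
End StrictDerivative.

(** * The rescaled contact equations *)

Ltac solve_strict_diff := lazymatch goal with
  | |- strict_diff _ (fun e x => @?f e x + @?g e x) _ _ =>
      refine (@strict_diffD _ _ _ _ f g _ _ _ _ _ _); cbv beta; solve_strict_diff
  | |- strict_diff _ (fun e x => @?f e x * @?g e x) _ _ =>
      refine (@strict_diffM _ _ _ _ f g _ _ _ _ _ _); cbv beta; solve_strict_diff
  | |- strict_diff _ (fun e x => - @?f e x) _ _ =>
      refine (@strict_diffN _ _ _ _ f _ _ _); cbv beta; solve_strict_diff
  | |- strict_diff _ (fun e x => fun_of_matrix x ?i ?j) _ _ =>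
      exact (@strict_diff_coord _ _ _ _ i j)
  | |- strict_diff _ (fun e x => @?c e) _ _ =>
      refine (@strict_diff_param _ _ _ _ c _ _); cbv beta;
      first [eassumption | exact: tends_cst]
  end.

Section ContactSystem.
Variable R : realType.
Local Notation V := 'M[R]_(3, 3).
Variable F : 'I_3 -> pointed_line R.
Variable line : 'I_3 -> bool.
Implicit Types (x h : V) (e s t g : R).

(** The counterpart of [along_scale]: the equation of the hyperbola divided by
    its leading order reads [v^2 = u^2 - gap_scale^2]. *)
Definition gap_scale (l : bool) e : R := if l then e else 1.

(** The unknown is a 3 x 3 matrix: the first row holds the coordinates of the circle
   (center, then squared norm of the center minus squared radius), the other two rows
   the rescaled coordinates of the three contacts. *)
Definition cen1 x := x idx0 idx0.
Definition cen2 x := x idx0 idx1.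
Definition cpow x := x idx0 idx2.

(** The conditions [touches] for the three contacts, each divided by the power of [e]
    that makes it regular at [e = 0]. *)
Definition contact_system e x : V := \matrix_(r, k)
  let u := x idx1 k in let v := x idx2 k in
  let al := lin_along (F k) 1 (cen1 x) (cen2 x) in
  let be := lin_across (F k) 1 (cen1 x) (cen2 x) in
  let p := power (F k) 1 (cen1 x) (cen2 x) (cpow x) in
  let c := along_scale (line k) e in
  if r == idx0 then v * v - u * u + gap_scale (line k) e * gap_scale (line k) e
  else if r == idx1 then
    c * c * u * u + e * e * c * c * v * v + al * c * u + be * e * c * v + p
  else v * (2 * c * u + al) + e * u * (be + 2 * e * c * v).

Lemma contact_systemP e x : e != 0 ->
  contact_system e x = 0 <-> forall k,
  touches e 1 (lin_along (F k) 1 (cen1 x) (cen2 x)) (lin_across (F k) 1 (cen1 x) (cen2 x))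
    (power (F k) 1 (cen1 x) (cen2 x) (cpow x))
    (along_scale (line k) e * x idx1 k) (e * along_scale (line k) e * x idx2 k).
Proof.
move=> e0; split=> [/matrixP G0 k|touch]; last first.
  apply/matrixP => r k; have [hQ hC hT] := touch k; rewrite !mxE /=.
  have c0 : along_scale (line k) e != 0 by rewrite /along_scale; case: line; rewrite ?oner_neq0.
  elim/idx_cases: r => /=.
  - apply: (mulfI (mulf_neq0 e0 e0)); apply: (mulfI (mulf_neq0 c0 c0)); rewrite !mulr0.
    move: hQ; rewrite /along_scale /gap_scale; case: line => hQ; lra.
  - rewrite -[RHS]hC; ring.
  - apply: (mulfI e0); apply: (mulfI c0); rewrite !mulr0 -[RHS]hT; ring.
have := G0 idx0 k; have := G0 idx1 k; have := G0 idx2 k; rewrite !mxE /= => h2 h1 h0.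
split.
- move: h0; rewrite /along_scale /gap_scale; case: line => h0.
    have -> : (1 * x idx1 k) ^+ 2 - e ^+ 2 = x idx2 k * x idx2 k by lra.
    ring.
  have -> : (e * x idx1 k) ^+ 2 - e ^+ 2 = e ^+ 2 * (x idx2 k * x idx2 k).
    have -> : x idx2 k * x idx2 k = x idx1 k * x idx1 k - 1 by lra.
    ring.
  ring.
- rewrite -[RHS]h1; ring.
- transitivity (e * along_scale (line k) e * 0); last by rewrite mulr0.
  rewrite -[X in _ = _ * X]h2; ring.
Qed.

Section Label.
Variables (sg : 'I_3 -> bool) (s t g : R).

Definition limit_circle : Prop := forall k,
  limit_contact (line k) (lin_along (F k) 1 s t) (power (F k) 1 s t g).

(** The contact points of the limit circle: the foot of its center on the line, or
    the marked point. *)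
Definition contact_px k : R :=
  ptx (F k) - (if line k then lin_along (F k) 1 s t / 2 * dirx (F k) else 0).
Definition contact_py k : R :=
  pty (F k) - (if line k then lin_along (F k) 1 s t / 2 * diry (F k) else 0).

(** The circle does not touch a line at its marked point, it is not reduced to a point of a
    line, and the three contact points are not collinear. *)
Record regular_circle : Prop := {
  along_neq0 : forall k, lin_along (F k) 1 s t != 0;
  across_neq0 : forall k, line k -> lin_across (F k) 1 s t != 0;
  contacts_indep :
    cross (contact_px idx1 - contact_px idx0) (contact_py idx1 - contact_py idx0)
      (contact_px idx2 - contact_px idx0) (contact_py idx2 - contact_py idx0) != 0 }.

Definition label_point : V := \matrix_(r, k)
  if r == idx0 then (if k == idx0 then s else if k == idx1 then t else g)
  else if r == idx1 then contact_u (line k) (sg k) (lin_along (F k) 1 s t)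
  else contact_v (line k) (sg k) (lin_along (F k) 1 s t).

Let al k := lin_along (F k) 1 s t.
Let pw k := power (F k) 1 s t g.

Hypothesis limitC : limit_circle.
Hypothesis regC : regular_circle.

(** The linearisation of [contact_system] at [e = 0]; the scale [along_scale] has become
    the number [c], and the terms with a factor [e] have disappeared. *)
Definition contact_differential (r k : 'I_3) h : R :=
  let u := contact_u (line k) (sg k) (al k) in
  let v := contact_v (line k) (sg k) (al k) in
  let c : R := (line k)%:R in
  let dal := - 2 * (dirx (F k) * cen1 h + diry (F k) * cen2 h) in
  let dpw := cpow h - 2 * (ptx (F k) * cen1 h + pty (F k) * cen2 h) in
  if r == idx0 then 2 * (v * h idx2 k - u * h idx1 k)
  else if r == idx1 then (2 * c * u + al k) * c * h idx1 k + c * u * dal + dpw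
  else (2 * c * u + al k) * h idx2 k + v * (2 * c * h idx1 k + dal).

(** The value and the derivative are left to unification and computed by
    [solve_strict_diff]; only their simplified forms are then checked. *)
Lemma contact_system_diff r k : exists2 d : V,
  strict_diff label_point (fun e x => contact_system e x r k) 0 d &
  forall h, dot d h = contact_differential r k h.
Proof.
have cast (d : V) (g1 g2 : R -> V -> R) v1 : v1 = 0 -> (forall e x, g1 e x = g2 e x) ->
    strict_diff label_point g2 v1 d -> strict_diff label_point g1 0 d.
  by move=> <- g12; have -> : g1 = g2 by apply/funext => e; apply/funext.
have e_lim : tends 0^'+ (fun e : R => e) 0.
  by apply: cvg_at_right_filter; exact: cvg_id.
have c_lim : tends 0^'+ (along_scale (line k)) ((line k)%:R : R).
  by rewrite /along_scale; case: (line k) => /=; [exact: tends_cst|exact: e_lim].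
have l_lim : tends 0^'+ (gap_scale (line k)) ((~~ line k)%:R : R).
  by rewrite /gap_scale; case: (line k) => /=; [exact: e_lim|exact: tends_cst].
have lim := limitC k.
elim/idx_cases: r.
- have [v [d [Hd vE dE]]] : exists v d, [/\ strict_diff label_point (fun e x =>
      x idx2 k * x idx2 k - x idx1 k * x idx1 k +
      gap_scale (line k) e * gap_scale (line k) e) v d, v = 0 & forall h, dot d h =
      2 * (contact_v (line k) (sg k) (al k) * h idx2 k -
           contact_u (line k) (sg k) (al k) * h idx1 k)].
    do 2!eexists; split; first solve_strict_diff.
      rewrite !mxE /=; move: lim; rewrite /contact_u /contact_v.
      by case: line => /= _; rewrite -?expr2 ?exprMn ?sqrr_sign; ring.
    by move=> h; rewrite !(dotDl, dotZl, dotNl, dot0l, dot_delta) !mxE /=; ring.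
  exists d; last exact: dE.
  by apply: cast Hd => // e x; rewrite mxE.
- rewrite /lin_along /lin_across /power.
  have [v [d [Hd vE dE]]] : exists v d, [/\ strict_diff label_point (fun e x =>
      let u := x idx1 k in let v := x idx2 k in
      let al := lin_along (F k) 1 (cen1 x) (cen2 x) in
      let be := lin_across (F k) 1 (cen1 x) (cen2 x) in
      let p := power (F k) 1 (cen1 x) (cen2 x) (cpow x) in
      let c := along_scale (line k) e in
      c * c * u * u + e * e * c * c * v * v + al * c * u + be * e * c * v + p) v d,
      v = 0 & forall h, dot d h =
      let u := contact_u (line k) (sg k) (al k) in
      let c : R := (line k)%:R in
      let dal := - 2 * (dirx (F k) * cen1 h + diry (F k) * cen2 h) in
      let dpw := cpow h - 2 * (ptx (F k) * cen1 h + pty (F k) * cen2 h) in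
      (2 * c * u + al k) * c * h idx1 k + c * u * dal + dpw].
    rewrite /lin_along /lin_across /power /cen1 /cen2 /cpow; cbv zeta.
    do 2!eexists; split; first solve_strict_diff.
      rewrite !mxE /=; move: lim; rewrite /contact_u /contact_v /al /pw /lin_along /power.
      by case: line => /= lim; lra.
    move=> h; rewrite !(dotDl, dotZl, dotNl, dot0l, dot_delta) !mxE /= /al /lin_along.
    by ring.
  exists d; last exact: dE.
  by apply: cast Hd => // e x; rewrite mxE.
- have [v [d [Hd vE dE]]] : exists v d, [/\ strict_diff label_point (fun e x =>
      let u := x idx1 k in let v := x idx2 k in
      let al := lin_along (F k) 1 (cen1 x) (cen2 x) in
      let be := lin_across (F k) 1 (cen1 x) (cen2 x) in
      let c := along_scale (line k) e in
      v * (2 * c * u + al) + e * u * (be + 2 * e * c * v)) v d,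
      v = 0 & forall h, dot d h =
      let u := contact_u (line k) (sg k) (al k) in
      let v := contact_v (line k) (sg k) (al k) in
      let c : R := (line k)%:R in
      let dal := - 2 * (dirx (F k) * cen1 h + diry (F k) * cen2 h) in
      (2 * c * u + al k) * h idx2 k + v * (2 * c * h idx1 k + dal)].
    rewrite /lin_along /lin_across /cen1 /cen2; cbv zeta.
    do 2!eexists; split; first solve_strict_diff.
      rewrite !mxE /= /contact_u /contact_v /al /lin_along.
      by case: line => /=; field.
    move=> h; rewrite !(dotDl, dotZl, dotNl, dot0l, dot_delta) !mxE /= /al /lin_along.
    by ring.
  exists d; last exact: dE.
  by apply: cast Hd => // e x; rewrite mxE.
Qed.

(** By the second row, the variation of the equation of the circle vanishes at the contact
    point.  This variation is an affine function on the plane; vanishing at three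
    points that are not collinear, it is zero.  The other two rows then show
    that the contacts do not vary either. *)
Lemma contact_kernel (h : V) : (forall r k, contact_differential r k h = 0) -> h = 0.
Proof.
rewrite /contact_differential => d0.
have inv2 : (2 : R) != 0 by rewrite pnatr_eq0.
have chord k : cpow h = 2 * (contact_px k * cen1 h + contact_py k * cen2 h).
  have := d0 idx1 k; rewrite /= /contact_px /contact_py /contact_u -/(al k).
  case: (line k) => /=; lra.
have [c1 c2] : cen1 h = 0 /\ cen2 h = 0.
  by apply: det2_eq0 (contacts_indep regC) _ _;
    [have := chord idx1|have := chord idx2]; have := chord idx0; lra.
have c3 : cpow h = 0 by rewrite (chord idx0) c1 c2; ring.
have uv0 k : h idx1 k = 0 /\ h idx2 k = 0.
  have := d0 idx0 k; have := d0 idx2 k; rewrite /= c1 c2 /contact_u /contact_v.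
  have al0 : al k != 0 := along_neq0 regC k.
  have sg0 : (-1) ^+ sg k != 0 :> R by rewrite signr_eq0.
  case: (line k) => /= e2 e0; last first.
    split; first by apply: (mulfI sg0); lra.
    by apply: (mulfI al0); lra.
  have h1 : h idx1 k = 0 by apply: (mulfI (mulf_neq0 sg0 al0)); lra.
  split => //; apply: (mulfI (mulf_neq0 sg0 al0)); rewrite h1 in e0; lra.
apply/matrixP => r k; rewrite mxE; have [h1 h2] := uv0 k.
elim/idx_cases: r => //; elim/idx_cases: k {h1 h2} => //.
Qed.

Lemma label_persists : exists2 rho, 0 < rho &
  exists2 phi : R -> V, phi @ 0^'+ --> label_point &
  \forall e \near 0^'+, contact_system e (phi e) = 0 /\
    forall x, `|x - label_point| <= rho -> contact_system e x = 0 -> x = phi e.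
Proof.
have [d dP dE] : exists2 d : 'I_3 -> 'I_3 -> V,
    forall r k, strict_diff label_point (fun e x => contact_system e x r k) 0 (d r k) &
    forall r k h, dot (d r k) h = contact_differential r k h.
  have ex r k := contact_system_diff r k.
  exists (fun r k => s2val (cid2 (ex r k))) => r k; first exact: s2valP.
  exact: (s2valP' (cid2 (ex r k))).
apply: system_zero_persists dP _ => h d0; apply: contact_kernel => r k.
by rewrite -dE.
Qed.

End Label.
End ContactSystem.

(** * Telling the nearby circles apart *)

Section OffsetLimit.
Variables (R : realType) (I : Type) (U : set_system I).
Context {properU : ProperFilter U}.
Variables (e al be p u v : I -> R) (al0 be0 u0 v0 : R).
Hypothesis e_cvg : tends U e 0.
Hypothesis e_neq0 : \forall i \near U, e i != 0.
Hypothesis al_cvg : tends U al al0.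
Hypothesis be_cvg : tends U be be0.
Hypothesis u_cvg : tends U u u0.
Hypothesis v_cvg : tends U v v0.

Lemma point_offset_limit :
  (\forall i \near U, e i * e i * u i * u i + e i * e i * e i * e i * v i * v i
     + al i * e i * u i + be i * e i * e i * v i + p i = 0) ->
  tends U (fun i => p i / e i) (- (al0 * u0)).
Proof.
move=> row.
have lim : tends U (fun i => - (e i * u i ^+ 2 + e i ^+ 3 * v i ^+ 2 + al i * u i + be i * e i * v i))
    (- (0 * u0 ^+ 2 + 0 ^+ 3 * v0 ^+ 2 + al0 * u0 + be0 * 0 * v0)) by solve_tends.
have -> : - (al0 * u0) = - (0 * u0 ^+ 2 + 0 ^+ 3 * v0 ^+ 2 + al0 * u0 + be0 * 0 * v0) by ring.
apply: (tends_near lim); apply: filterS (filterI e_neq0 row) => i [e0 h].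
by apply: (canLR (mulfK e0)); lra.
Qed.

(** The circle equation reads [al^2 / 4 - p = (u + al / 2)^2 + e^2 v^2 + be e v], where the
    tangency equation makes [u + al / 2] of order [e]. *)
Lemma line_offset_limit : v0 != 0 ->
  (\forall i \near U, u i * u i + e i * e i * v i * v i + al i * u i
     + be i * e i * v i + p i = 0) ->
  (\forall i \near U, v i * (2 * u i + al i) + e i * u i * (be i + 2 * e i * v i) = 0) ->
  tends U (fun i => (al i ^+ 2 / 4 - p i) / e i) (be0 * v0).
Proof.
move=> v00 row1 row2.
have lim : tends U (fun i => e i * (u i * (be i + 2 * e i * v i) / (2 * v i)) ^+ 2
     + e i * v i ^+ 2 + be i * v i)
    (0 * (u0 * (be0 + 2 * 0 * v0) / (2 * v0)) ^+ 2 + 0 * v0 ^+ 2 + be0 * v0).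
  by solve_tends; rewrite mulf_neq0// pnatr_eq0.
have -> : be0 * v0 = 0 * (u0 * (be0 + 2 * 0 * v0) / (2 * v0)) ^+ 2 + 0 * v0 ^+ 2 + be0 * v0 by ring.
have v_neq0 : \forall i \near U, v i != 0 by exact: tends_neq0 v_cvg v00.
apply: (tends_near lim).
apply: filterS (filterI (filterI e_neq0 v_neq0) (filterI row1 row2)) => i [[e0 vn0] [h1 h2]].
apply: (canLR (mulfK e0)).
have slope : u i + al i / 2 = - e i * (u i * (be i + 2 * e i * v i) / (2 * v i)).
  apply: (mulfI vn0); rewrite (_ : v i * (- e i * _) = - (e i * u i * (be i + 2 * e i * v i)) / 2).
    lra.
  by field.
have -> : al i ^+ 2 / 4 - p i = (u i + al i / 2) ^+ 2 + e i ^+ 2 * v i ^+ 2 + be i * e i * v i by lra.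
by rewrite slope; ring.
Qed.

End OffsetLimit.

Section SignLimit.
Variable R : realType.
Local Notation V := 'M[R]_(3, 3).
Variable F : 'I_3 -> pointed_line R.
Variables (line sg : 'I_3 -> bool) (s t g : R).
Hypothesis regC : regular_circle F line s t.
Variables (U : set_system R) (phi : R -> V).
Context {properU : ProperFilter U}.
Hypothesis U_right : 0^'+ `<=` U.
Hypothesis phi_cvg : phi @ U --> label_point F line sg s t g.
Hypothesis phi_zero : \forall e \near U, contact_system F line e (phi e) = 0.

(** How far the circle is from satisfying the limit condition. *)
Definition offset (l : bool) (al p : R) : R := if l then al ^+ 2 / 4 - p else p.

Definition offset_slope (l : bool) (al be : R) : R := if l then - (be * al) / 2 else - al.

(** The first order in [e] of the offset changes sign with the bit [sg]; this
    separates circles with the same limit. *)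
Lemma offset_limit k :
  tends U (fun e => offset (line k) (lin_along (F k) 1 (cen1 (phi e)) (cen2 (phi e)))
     (power (F k) 1 (cen1 (phi e)) (cen2 (phi e)) (cpow (phi e))) / e)
   ((-1) ^+ sg k * offset_slope (line k) (lin_along (F k) 1 s t) (lin_across (F k) 1 s t)).
Proof.
have e_cvg := tends_right_id U_right.
have e_neq0 : \forall e \near U, e != 0.
  by apply: U_right; near=> e; rewrite gt_eqF//; near: e; exact: nbhs_right_gt.
have s_cvg := mx_entry_tends idx0 idx0 phi_cvg; have t_cvg := mx_entry_tends idx0 idx1 phi_cvg.
have u_cvg := mx_entry_tends idx1 k phi_cvg; have v_cvg := mx_entry_tends idx2 k phi_cvg.
rewrite /label_point !mxE /= in s_cvg t_cvg u_cvg v_cvg.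
have al_cvg : tends U (fun e => lin_along (F k) 1 (cen1 (phi e)) (cen2 (phi e)))
    (lin_along (F k) 1 s t).
  by rewrite /lin_along /cen1 /cen2; solve_tends.
have be_cvg : tends U (fun e => lin_across (F k) 1 (cen1 (phi e)) (cen2 (phi e)))
    (lin_across (F k) 1 s t).
  by rewrite /lin_across /cen1 /cen2; solve_tends.
have al0 := along_neq0 regC k.
have sg0 : (-1) ^+ sg k != 0 :> R by rewrite signr_eq0.
have row1 : \forall e \near U, contact_system F line e (phi e) idx1 k = 0.
  by apply: filterS phi_zero => e ->; rewrite mxE.
have row2 : \forall e \near U, contact_system F line e (phi e) idx2 k = 0.
  by apply: filterS phi_zero => e ->; rewrite mxE.
move: u_cvg v_cvg; rewrite /contact_u /contact_v /offset /offset_slope.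
case lk: (line k) => /= u_cvg v_cvg.
  rewrite (_ : (-1) ^+ sg k * (- (lin_across (F k) 1 s t * lin_along (F k) 1 s t) / 2) =
    lin_across (F k) 1 s t * ((-1) ^+ sg k * (- lin_along (F k) 1 s t / 2))); last by ring.
  apply: (@line_offset_limit _ _ U _ _ (fun e => lin_along (F k) 1 (cen1 (phi e)) (cen2 (phi e))) _
    (fun e => power (F k) 1 (cen1 (phi e)) (cen2 (phi e)) (cpow (phi e)))
    _ _ _ _ _ e_cvg e_neq0 be_cvg u_cvg v_cvg).
  - by rewrite !mulf_neq0 ?invr_eq0 ?oppr_eq0 ?pnatr_eq0.
  - by apply: filterS row1 => e; rewrite mxE /= lk /= !mul1r !mulr1.
  - by apply: filterS row2 => e; rewrite mxE /= lk /= !mulr1.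
rewrite (_ : (-1) ^+ sg k * - lin_along (F k) 1 s t =
    - (lin_along (F k) 1 s t * (-1) ^+ sg k)); last by ring.
apply: (@point_offset_limit _ _ U _ _ _ _ (fun e => power (F k) 1 (cen1 (phi e)) (cen2 (phi e)) (cpow (phi e)))
  _ _ _ _ _ _ e_cvg e_neq0 al_cvg be_cvg u_cvg v_cvg).
by apply: filterS row1 => e; rewrite mxE /= lk.
Unshelve. all: by end_near. Qed.

End SignLimit.

(** * Counting the touching circles *)

Section Counting.
Variable R : realType.
Local Notation V := 'M[R]_(3, 3).
Local Notation types := {ffun 'I_3 -> bool}.
Local Notation circle := (R * R * R)%type.
Variable F : 'I_3 -> pointed_line R.
Hypothesis genF : generic_lines F.

(** The real circles, in the coordinates (center, power of the origin), that touch the three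
    hyperbolas of parameter [e]. *)
Definition touching (e : R) : set circle := [set C | forall k, exists X Y,
  touches e 1 (lin_along (F k) 1 C.1.1 C.1.2) (lin_across (F k) 1 C.1.1 C.1.2)
    (power (F k) 1 C.1.1 C.1.2 C.2) X Y].

(** [L] lists the limit circles with their types of contact; [labels] pairs them with the
    bits of the three contacts, and [phi] is the continuation of each label. *)
Variable L : seq (types * circle).
Hypothesis L_complete : forall (l : types) (C : circle),
  limit_circle F l C.1.1 C.1.2 C.2 -> (l, C) \in L.
Hypothesis L_limit : forall l C, (l, C) \in L -> limit_circle F l C.1.1 C.1.2 C.2.
Hypothesis L_regular : forall l C, (l, C) \in L -> regular_circle F l C.1.1 C.1.2.
Hypothesis L_uniq : uniq L.

Definition labels : seq ((types * circle) * types) :=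
  [seq (c, sg) | c <- L, sg <- enum {: types}].

Lemma size_labels : size labels = (size L * 8)%N.
Proof. by rewrite size_allpairs -cardE card_ffun card_bool card_ord. Qed.

Lemma labels_uniq : uniq labels.
Proof. by apply: allpairs_uniq => //; [exact: enum_uniq|move=> [? ?] [? ?]]. Qed.

Lemma mem_labels c sg : ((c, sg) \in labels) = (c \in L).
Proof.
apply/allpairsP/idP => [[[c' sg'] /= [cL _ [-> _]]] //|cL].
by exists (c, sg); split => //=; rewrite mem_enum.
Qed.

Definition label_limit (lab : (types * circle) * types) : V :=
  label_point F lab.1.1 lab.2 lab.1.2.1.1 lab.1.2.1.2 lab.1.2.2.

Definition circle_of (x : V) : circle := (cen1 x, cen2 x, cpow x).

Lemma near_all_seq (T : eqType) (U : set_system R) (r : seq T) (P : T -> set R) :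
  Filter U -> (forall l, l \in r -> \forall e \near U, P l e) ->
  \forall e \near U, forall l, l \in r -> P l e.
Proof.
move=> FU; elim: r => [|a r IHr] near_r; first by apply: nearW => e l; rewrite in_nil.
have near_a := near_r a (mem_head a r).
have {}IHr := IHr (fun l lr => near_r l (mem_behead (s := a :: r) lr)).
apply: filterS (filterI near_a IHr) => e [Pa Pr] l.
by rewrite inE => /predU1P[->|/Pr].
Qed.

Variables (rho : (types * circle) * types -> R) (phi : (types * circle) * types -> R -> V).
Hypothesis rho_gt0 : forall lab, lab \in labels -> 0 < rho lab.
Hypothesis phi_cvg : forall lab, lab \in labels -> phi lab @ 0^'+ --> label_limit lab.
Hypothesis phi_zero : forall lab, lab \in labels -> \forall e \near 0^'+,
  contact_system F lab.1.1 e (phi lab e) = 0.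
Hypothesis phi_uniq : forall lab, lab \in labels -> \forall e \near 0^'+,
  forall x, `|x - label_limit lab| <= rho lab -> contact_system F lab.1.1 e x = 0 ->
    x = phi lab e.

Lemma limit_types_unique l l' C : (l, C) \in L -> (l', C) \in L -> l = l'.
Proof.
move=> lC l'C; apply/ffunP => k.
have := L_limit lC k; have := L_limit l'C k; have := along_neq0 (L_regular lC) k.
set al := lin_along _ _ _ _; set p := power _ _ _ _ _.
rewrite /limit_contact; case: (l k); case: (l' k) => // al0 h1 h2; exfalso.
  by move: h2; rewrite h1 mulr0 => /eqP; rewrite sqrf_eq0 (negPf al0).
by move: h1; rewrite h2 mulr0 => /eqP; rewrite sqrf_eq0 (negPf al0).
Qed.

(** Two labels with the same circle for arbitrarily small [e] have the same limit circle, hence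
    the same types of contact, and then the same bits by [offset_limit]. *)
Lemma labels_separated : \forall e \near 0^'+, forall lab lab',
  lab \in labels -> lab' \in labels ->
  circle_of (phi lab e) = circle_of (phi lab' e) -> lab = lab'.
Proof.
suff sep lab lab' : lab \in labels -> lab' \in labels -> lab != lab' ->
    \forall e \near 0^'+, circle_of (phi lab e) <> circle_of (phi lab' e).
  have near_all : \forall e \near 0^'+, forall lab, lab \in labels ->
     forall lab', lab' \in labels -> lab != lab' ->
     circle_of (phi lab e) <> circle_of (phi lab' e).
    apply: near_all_seq => lab labL; apply: near_all_seq => lab' labL'.
    have [->|ne] := eqVneq lab lab'; first by apply: nearW.
    by apply: filterS (sep _ _ labL labL' ne).
  apply: filterS near_all => e sepe lab lab' labL labL' eqC.
  by apply/eqP; apply: contraT => ne; case: (sepe _ labL _ labL' ne).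
move=> labL labL' ne; apply: near_ultra => U ultraU U_right.
have [//|same] := in_ultra_setVsetC
  [set e | circle_of (phi lab e) <> circle_of (phi lab' e)] ultraU.
exfalso; move/eqP: ne; apply.
have {}same : \forall e \near U, circle_of (phi lab e) = circle_of (phi lab' e).
  by apply: filterS same => e /contrapT.
have cvgU la : la \in labels -> phi la @ U --> label_limit la.
  by move=> laL; apply: cvg_trans (phi_cvg laL) => A; exact: U_right.
have zeroU la : la \in labels -> \forall e \near U, contact_system F la.1.1 e (phi la e) = 0.
  by move=> laL; apply: U_right; exact: phi_zero.
have sameE r : \forall e \near U, phi lab e idx0 r = phi lab' e idx0 r.
  apply: filterS same => e; rewrite /circle_of /cen1 /cen2 /cpow => -[? ? ?].
  by elim/idx_cases: r.
have limE r : label_limit lab idx0 r = label_limit lab' idx0 r.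
  have lim := mx_entry_tends idx0 r (cvgU _ labL).
  have lim' := mx_entry_tends idx0 r (cvgU _ labL').
  exact: tends_unique lim lim' (sameE r).
case: lab lab' labL labL' same sameE limE => [[l [[s t] g]] sg] [[l' [[s' t'] g']] sg'].
move=> labL labL' same sameE limE.
have [E1 E2 E3] : [/\ s = s', t = t' & g = g'].
  by have := limE idx0; have := limE idx1; have := limE idx2; rewrite !mxE.
subst s' t' g'.
have lE : l = l'.
  by move: labL labL'; rewrite !mem_labels; exact: limit_types_unique.
subst l'; congr (_, _); apply/ffunP => k.
have regC : regular_circle F l s t by move: labL; rewrite mem_labels => /L_regular.
have lim := @offset_limit _ _ _ _ _ _ _ regC _ _ _ U_right (cvgU _ labL) (zeroU _ labL) k.
have lim' := @offset_limit _ _ _ _ _ _ _ regC _ _ _ U_right (cvgU _ labL') (zeroU _ labL') k.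
have properU : ProperFilter U by exact: ultra_proper.
have slope : (-1) ^+ sg k * offset_slope (l k) (lin_along (F k) 1 s t) (lin_across (F k) 1 s t) =
    (-1) ^+ sg' k * offset_slope (l k) (lin_along (F k) 1 s t) (lin_across (F k) 1 s t).
  apply: tends_unique (lim properU) (lim' properU) _.
  by apply: filterS same => e; rewrite /circle_of => -[-> -> ->].
have slope0 : offset_slope (l k) (lin_along (F k) 1 s t) (lin_across (F k) 1 s t) != 0.
  have al0 := along_neq0 regC k; have be0 := @across_neq0 _ _ _ _ _ regC k.
  rewrite /offset_slope; case: (l k) be0 => [/(_ isT) be0|_]; last by rewrite oppr_eq0.
  by rewrite !mulf_neq0 ?invr_eq0 ?pnatr_eq0// oppr_eq0 mulf_neq0.
have /eqP := mulIf slope0 slope.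
by case: (sg k); case: (sg' k) => //; rewrite expr0 expr1 => /eqP ?; lra.
Qed.

(** If the labels miss some touching circle for arbitrarily small [e], choose one for each
    such [e], with its contacts.  Along an ultrafilter the circles converge, then the
    rescaled contacts do, and the limit is a label; by uniqueness the chosen circle
    is eventually the continuation of this label. *)
Lemma labels_exhaust : \forall e \near 0^'+, forall C, touching e C ->
  exists2 lab, lab \in labels & C = circle_of (phi lab e).
Proof.
apply: near_ultra => U ultraU U_right.
pose missed e C := touching e C /\ forall lab, lab \in labels -> C <> circle_of (phi lab e).
have [UP|UnP] := in_ultra_setVsetC (fun e => ~ exists C, missed e C) ultraU.
  apply: filterS UP => e none C touchC; apply: contrapT => noC; apply: none.
  by exists C; split => // lab labL CE; apply: noC; exists lab.
exfalso; have properU : ProperFilter U by exact: ultra_proper.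
have {UnP} bad : \forall e \near U, exists C, missed e C.
  by apply: filterS UnP => e /contrapT.
have [C CP] : exists C : R -> circle, \forall e \near U, missed e (C e).
  have /choice [C CP] : forall e, exists C, (exists C, missed e C) -> missed e C.
    move=> e; have [[C mC]|no] := pselect (exists C, missed e C); first by exists C.
    by exists (0, 0, 0).
  by exists C; apply: filterS bad => e; exact: CP.
have [XY XYP] : exists XY : 'I_3 -> R -> R * R, forall k, \forall e \near U,
    touches e 1 (lin_along (F k) 1 (C e).1.1 (C e).1.2)
      (lin_across (F k) 1 (C e).1.1 (C e).1.2)
      (power (F k) 1 (C e).1.1 (C e).1.2 (C e).2) (XY k e).1 (XY k e).2.
  have /choice [XY XYP] : forall ke : 'I_3 * R, exists xy : R * R,
      missed ke.2 (C ke.2) ->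
      touches ke.2 1 (lin_along (F ke.1) 1 (C ke.2).1.1 (C ke.2).1.2)
      (lin_across (F ke.1) 1 (C ke.2).1.1 (C ke.2).1.2)
      (power (F ke.1) 1 (C ke.2).1.1 (C ke.2).1.2 (C ke.2).2) xy.1 xy.2.
    move=> [k e] /=; have [[touchC _]|no] := pselect (missed e (C e)); last by exists (0, 0).
    by have [X [Y ?]] := touchC k; exists (X, Y).
  by exists (fun k e => XY (k, e)) => k; apply: filterS CP => e; exact: (XYP (k, e)).
have e_gt0 : \forall e \near U, 0 < e.
  by apply: U_right; exact: nbhs_right_gt.
have e_cvg := tends_right_id U_right.
have [s [t [g [s_cvg t_cvg g_cvg]]]] := touching_circles_bounded genF ultraU e_gt0 e_cvg XYP.
pose al k e := lin_along (F k) 1 (C e).1.1 (C e).1.2.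
pose be k e := lin_across (F k) 1 (C e).1.1 (C e).1.2.
pose p k e := power (F k) 1 (C e).1.1 (C e).1.2 (C e).2.
have al_cvg k : tends U (al k) (lin_along (F k) 1 s t).
  by rewrite /al /lin_along; solve_tends.
have be_cvg k : tends U (be k) (lin_across (F k) 1 s t).
  by rewrite /be /lin_across; solve_tends.
have p_cvg k : tends U (p k) (power (F k) 1 s t g).
  by rewrite /p /power; solve_tends.
have contact k := contact_limit ultraU e_gt0 e_cvg (al_cvg k) (be_cvg k) (p_cvg k) (XYP k).
(* [contact_limit] excludes a limit circle touching the line at the marked point.  Such a
   circle would still be a limit circle of some type, hence be in [L] and regular, which
   it is not. *)
have [l0 l0P] : exists l0 : types, limit_circle F l0 s t g.
  have /choice [l0 l0P] : forall k, exists b,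
      limit_contact b (lin_along (F k) 1 s t) (power (F k) 1 s t g).
    move=> k; have [[_ p0]|nb] := pselect
      (lin_along (F k) 1 s t = 0 /\ power (F k) 1 s t g = 0); first by exists false.
    by have [b [sg [? _ _]]] := contact k nb; exists b.
  by exists (finfun l0) => k; rewrite ffunE.
have regC0 := L_regular (@L_complete l0 (s, t, g) l0P).
have /choice [bb bbP] : forall k, exists bb : bool * bool,
  [/\ limit_contact bb.1 (lin_along (F k) 1 s t) (power (F k) 1 s t g),
    tends U (fun e => (XY k e).1 / along_scale bb.1 e) (contact_u bb.1 bb.2 (lin_along (F k) 1 s t))
    & tends U (fun e => (XY k e).2 / (e * along_scale bb.1 e))
        (contact_v bb.1 bb.2 (lin_along (F k) 1 s t))].
  move=> k; have [|b [sg ?]] := contact k; last by exists (b, sg).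
  by move=> [al0 _]; have /negP := along_neq0 regC0 k; apply; apply/eqP.
pose l : types := [ffun k => (bb k).1]; pose sg : types := [ffun k => (bb k).2].
have lC : (l, (s, t, g)) \in L.
  by apply: L_complete => k; rewrite /l ffunE /=; have [] := bbP k.
pose lab := ((l, (s, t, g)), sg).
have labL : lab \in labels by rewrite mem_labels.
pose x e : V := \matrix_(r, k)
  if r == idx0 then (if k == idx0 then (C e).1.1 else if k == idx1 then (C e).1.2 else (C e).2)
  else if r == idx1 then (XY k e).1 / along_scale (l k) e
  else (XY k e).2 / (e * along_scale (l k) e).
have x_cvg r k : tends U (fun e => x e r k) (label_limit lab r k).
  have E : (fun e => x e r k) = (fun e => if r == idx0 then
     (if k == idx0 then (C e).1.1 else if k == idx1 then (C e).1.2 else (C e).2)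
     else if r == idx1 then (XY k e).1 / along_scale (l k) e
     else (XY k e).2 / (e * along_scale (l k) e)).
    by apply/funext => e; rewrite mxE.
  rewrite E mxE /= /l /sg !ffunE; have [_ u_cvg v_cvg] := bbP k.
  elim/idx_cases: r {E} => //=.
  by elim/idx_cases: k {u_cvg v_cvg} => /=.
have x_near : \forall e \near U, `|x e - label_limit lab| <= rho lab.
  have near_entries : \forall e \near U, forall r k, `|label_limit lab r k - x e r k| <= rho lab.
    apply: filter_forall => r; apply: filter_forall => k.
    by have /cvgrPdist_le := x_cvg r k; apply; exact: rho_gt0.
  apply: filterS near_entries => e xe; apply: norm_le_entries; first exact: ltW (rho_gt0 labL).
  by move=> r k; have := xe r k; rewrite distrC !mxE.
have x_zero : \forall e \near U, contact_system F l e (x e) = 0.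
  have XYall : \forall e \near U, forall k,
    touches e 1 (lin_along (F k) 1 (C e).1.1 (C e).1.2)
      (lin_across (F k) 1 (C e).1.1 (C e).1.2)
      (power (F k) 1 (C e).1.1 (C e).1.2 (C e).2) (XY k e).1 (XY k e).2.
    by apply: filter_forall => k; exact: XYP.
  apply: filterS (filterI e_gt0 XYall) => e [e0 touche].
  have e0' : e != 0 by rewrite gt_eqF.
  apply/(contact_systemP F l _ e0') => k; rewrite /cen1 /cen2 /cpow !mxE /=.
  have c0 : along_scale (l k) e != 0.
    by rewrite /along_scale; case: (l k); rewrite ?oner_neq0.
  have -> : along_scale (l k) e * ((XY k e).1 / along_scale (l k) e) = (XY k e).1.
    by rewrite mulrC divfK.
  have -> : e * along_scale (l k) e * ((XY k e).2 / (e * along_scale (l k) e)) = (XY k e).2.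
    by rewrite mulrC divfK// mulf_neq0.
  exact: touche.
have uniq := U_right _ (phi_uniq labL).
have /filter_ex [e [[xe xz] [[_ missedC] uniqe]]] : U (fun e =>
    (`|x e - label_limit lab| <= rho lab /\ contact_system F l e (x e) = 0) /\
    (missed e (C e) /\ forall x, `|x - label_limit lab| <= rho lab ->
       contact_system F lab.1.1 e x = 0 -> x = phi lab e)).
  by apply: filterI; [exact: filterI|exact: filterI].
apply: (missedC lab labL); rewrite -(uniqe _ xe xz) /circle_of /cen1 /cen2 /cpow !mxE /=.
by case: (C e) => [[]].
Qed.

Lemma labels_touch : \forall e \near 0^'+, forall lab, lab \in labels ->
  touching e (circle_of (phi lab e)).
Proof.
apply: near_all_seq => lab labL.
have e_gt0 : \forall e \near 0^'+, (0 : R) < e by exact: nbhs_right_gt.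
apply: filterS (filterI e_gt0 (phi_zero labL)) => e [e0 z] k.
have e0' : e != 0 by rewrite gt_eqF.
have := (contact_systemP F lab.1.1 (phi lab e) e0').1 z k => touch.
by do 2 eexists; exact: touch.
Qed.

End Counting.

Theorem touching_circles_counted (R : realType) (F : 'I_3 -> pointed_line R)
    (L : seq ({ffun 'I_3 -> bool} * (R * R * R))) :
  generic_lines F -> uniq L ->
  (forall (l : {ffun 'I_3 -> bool}) C, (l, C) \in L <-> limit_circle F l C.1.1 C.1.2 C.2) ->
  (forall (l : {ffun 'I_3 -> bool}) C, (l, C) \in L -> regular_circle F l C.1.1 C.1.2) ->
  \forall e \near 0^'+, exists r : seq (R * R * R),
    [/\ uniq r, size r = (size L * 8)%N & forall C, touching F e C <-> C \in r].
Proof.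
move=> genF uniqL memL regL.
have limL (l : {ffun 'I_3 -> bool}) C : (l, C) \in L -> limit_circle F l C.1.1 C.1.2 C.2 by move/memL.
have complL (l : {ffun 'I_3 -> bool}) C : limit_circle F l C.1.1 C.1.2 C.2 -> (l, C) \in L by move=> ?; apply/memL.
have /choice [rp rpP] : forall lab, exists rp : R * (R -> 'M[R]_(3, 3)), lab \in labels L ->
   [/\ 0 < rp.1, rp.2 @ 0^'+ --> label_limit F lab &
     \forall e \near 0^'+, contact_system F lab.1.1 e (rp.2 e) = 0 /\
       forall x, `|x - label_limit F lab| <= rp.1 -> contact_system F lab.1.1 e x = 0 ->
       x = rp.2 e].
  move=> [[l C] sg]; have [lC|nlC] := boolP ((l, C) \in L); last first.
    by exists (0, fun=> 0); rewrite mem_labels (negPf nlC).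
  have [rho rho0 [phi phi_cvg phiP]] := label_persists sg (limL _ _ lC) (regL _ _ lC).
  by exists (rho, phi).
pose rho lab := (rp lab).1; pose phi lab := (rp lab).2.
have rho_gt0 lab : lab \in labels L -> 0 < rho lab by case/rpP.
have phi_cvg lab : lab \in labels L -> phi lab @ 0^'+ --> label_limit F lab by case/rpP.
have phi_zero lab : lab \in labels L -> \forall e \near 0^'+,
    contact_system F lab.1.1 e (phi lab e) = 0.
  by case/rpP => _ _; apply: filterS => e [].
have phi_uniq lab : lab \in labels L -> \forall e \near 0^'+,
    forall x, `|x - label_limit F lab| <= rho lab -> contact_system F lab.1.1 e x = 0 ->
    x = phi lab e.
  by case/rpP => _ _; apply: filterS => e [].
have sep := labels_separated limL regL phi_cvg phi_zero.
have exh := labels_exhaust genF complL regL rho_gt0 phi_uniq.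
have tch := labels_touch phi_zero.
apply: filterS (filterI sep (filterI exh tch)) => e [sepe [exhe tche]].
exists [seq circle_of (phi lab e) | lab <- labels L]; split.
- by rewrite map_inj_in_uniq ?labels_uniq// => lab lab' *; exact: sepe.
- by rewrite size_map size_labels.
- move=> C; split=> [/exhe [lab labL ->]|/mapP [lab labL ->]]; last exact: tche.
  exact: map_f.
Qed.

(** * From contact equations to tangent circles *)

Section Bridge.
Variable R : realType.
Implicit Types (f : pointed_line R) (e s t r g x y u v X Y : R).

Definition frame_x f x y : R := dirx f * (x - ptx f) + diry f * (y - pty f).
Definition frame_y f x y : R := dirx f * (y - pty f) - diry f * (x - ptx f).

Definition thin_hyperbola e f x y : R :=
  e ^+ 2 * frame_x f x y ^+ 2 - frame_y f x y ^+ 2 - e ^+ 4.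

Lemma thin_hyperbola_real_conic e f : e != 0 -> dirx f ^+ 2 + diry f ^+ 2 = 1 ->
  real_conic (thin_hyperbola e f).
Proof.
move=> e0 unit_dir.
pose m := dirx f * ptx f + diry f * pty f; pose n := dirx f * pty f - diry f * ptx f.
exists (e ^+ 2 * dirx f ^+ 2 - diry f ^+ 2), (2 * (e ^+ 2 + 1) * dirx f * diry f),
  (e ^+ 2 * diry f ^+ 2 - dirx f ^+ 2), (- 2 * e ^+ 2 * dirx f * m - 2 * diry f * n),
  (- 2 * e ^+ 2 * diry f * m + 2 * dirx f * n), (e ^+ 2 * m ^+ 2 - n ^+ 2 - e ^+ 4).
split=> [[a0 b0 c0]|x y]; last by rewrite /thin_hyperbola /frame_x /frame_y /m /n; ring.
have /negP : e ^+ 2 != 0 by rewrite expf_neq0.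
apply; apply/eqP.
transitivity ((e ^+ 2 * dirx f ^+ 2 - diry f ^+ 2) * dirx f ^+ 2 +
  (2 * (e ^+ 2 + 1) * dirx f * diry f) * dirx f * diry f +
  (e ^+ 2 * diry f ^+ 2 - dirx f ^+ 2) * diry f ^+ 2).
  have unit2 : (dirx f ^+ 2 + diry f ^+ 2) ^+ 2 = 1 by rewrite unit_dir expr1n.
  by rewrite -[LHS]mulr1 -[X in _ * X = _]unit2; ring.
by rewrite a0 b0 c0 !mul0r !addr0.
Qed.

Lemma derive1_quadratic (a b c u : R) :
  derive1 (fun x => a * x ^+ 2 + b * x + c) u = 2 * a * u + b.
Proof.
rewrite derive1E; apply: derive_val; apply: trigger_derive.
by rewrite /GRing.scale /=; ring.
Qed.

Lemma det_row_mx2 (A B : 'cV[R]_2) :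
  \det (row_mx A B : 'M[R]_2) = A 0 0 * B 1 0 - A 1 0 * B 0 0.
Proof.
have det2 (M : 'M[R]_2) : \det M = M 0 0 * M 1 1 - M 0 1 * M 1 0.
  rewrite (expand_det_row _ 0) !big_ord_recl big_ord0 /cofactor !det_mx11 !mxE /=.
  have -> : lift 0 0 = 1 :> 'I_2 by exact: val_inj.
  have -> : lift 1 0 = 0 :> 'I_2 by exact: val_inj.
  by rewrite expr0 expr1; ring.
have e0 i : (row_mx A B : 'M[R]_2) i 0 = A i 0.
  by have := row_mxEl A B i 0; congr (_ = _); congr (_ _ _); exact: val_inj.
have e1 i : (row_mx A B : 'M[R]_2) i 1 = B i 0.
  by have := row_mxEr A B i 0; congr (_ = _); congr (_ _ _); exact: val_inj.
by rewrite det2 !e0 !e1; ring.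
Qed.

Lemma det_gradients (Q C : R -> R -> R) u v (qx qy cx cy : R) :
  derive1 (fun x => Q x v) u = qx -> derive1 (fun y => Q u y) v = qy ->
  derive1 (fun x => C x v) u = cx -> derive1 (fun y => C u y) v = cy ->
  \det (row_mx (gradient Q u v) (gradient C u v) : 'M[R]_2) = qx * cy - qy * cx.
Proof. by move=> Qx Qy Cx Cy; rewrite det_row_mx2 !mxE /= Qx Qy Cx Cy. Qed.

Lemma derive1_eq_quadratic (h : R -> R) (a b c u d : R) :
  (forall x, h x = a * x ^+ 2 + b * x + c) -> 2 * a * u + b = d -> derive1 h u = d.
Proof. by move=> /funext -> <-; exact: derive1_quadratic. Qed.

Lemma tangent_atP e f s t r u v : dirx f ^+ 2 + diry f ^+ 2 = 1 ->
  tangent_at (thin_hyperbola e f) (circle_eq s t r) u v <->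
  touches e 1 (lin_along f 1 s t) (lin_across f 1 s t)
    (power f 1 s t (s ^+ 2 + t ^+ 2 - r ^+ 2)) (frame_x f u v) (frame_y f u v).
Proof.
move=> unit_dir.
pose X := frame_x f u v; pose Y := frame_y f u v.
have detE : \det (row_mx (gradient (thin_hyperbola e f) u v)
      (gradient (circle_eq s t r) u v) : 'M[R]_2) =
    2 * (e ^+ 2 * X * (2 * 1 * Y + lin_across f 1 s t) + Y * (2 * 1 * X + lin_along f 1 s t)).
  pose m := dirx f * ptx f + diry f * pty f; pose n := dirx f * pty f - diry f * ptx f.
  rewrite (@det_gradients _ _ u v (2 * e ^+ 2 * X * dirx f + 2 * Y * diry f)
    (2 * e ^+ 2 * X * diry f - 2 * Y * dirx f) (2 * (u - s)) (2 * (v - t))).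
  - by rewrite /X /Y /frame_x /frame_y /lin_along /lin_across; ring.
  - apply: (@derive1_eq_quadratic _ (e ^+ 2 * dirx f ^+ 2 - diry f ^+ 2)
      (2 * e ^+ 2 * dirx f * (diry f * v - m) + 2 * diry f * (dirx f * v - n))
      (e ^+ 2 * (diry f * v - m) ^+ 2 - (dirx f * v - n) ^+ 2 - e ^+ 4)).
      by move=> x; rewrite /thin_hyperbola /frame_x /frame_y /m /n; ring.
    by rewrite /X /Y /frame_x /frame_y /m /n; ring.
  - apply: (@derive1_eq_quadratic _ (e ^+ 2 * diry f ^+ 2 - dirx f ^+ 2)
      (2 * e ^+ 2 * diry f * (dirx f * u - m) + 2 * dirx f * (diry f * u + n))
      (e ^+ 2 * (dirx f * u - m) ^+ 2 - (diry f * u + n) ^+ 2 - e ^+ 4)).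
      by move=> y; rewrite /thin_hyperbola /frame_x /frame_y /m /n; ring.
    by rewrite /X /Y /frame_x /frame_y /m /n; ring.
  - apply: (@derive1_eq_quadratic _ 1 (- 2 * s) (s ^+ 2 + (v - t) ^+ 2 - r ^+ 2)).
      by move=> x; rewrite /circle_eq; ring.
    by ring.
  - apply: (@derive1_eq_quadratic _ 1 (- 2 * t) ((u - s) ^+ 2 + t ^+ 2 - r ^+ 2)).
      by move=> y; rewrite /circle_eq; ring.
    by ring.
have circE : circle_eq s t r u v = 1 * (X ^+ 2 + Y ^+ 2) + lin_along f 1 s t * X
    + lin_across f 1 s t * Y + power f 1 s t (s ^+ 2 + t ^+ 2 - r ^+ 2).
  have -> : circle_eq s t r u v =
      (dirx f ^+ 2 + diry f ^+ 2) * ((u - ptx f) ^+ 2 + (v - pty f) ^+ 2)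
      + (dirx f ^+ 2 + diry f ^+ 2) * 2 * ((u - ptx f) * (ptx f - s) + (v - pty f) * (pty f - t))
      + power f 1 s t (s ^+ 2 + t ^+ 2 - r ^+ 2).
    by rewrite unit_dir /circle_eq /power; ring.
  by rewrite /X /Y /frame_x /frame_y /lin_along /lin_across; ring.
have hypE : thin_hyperbola e f u v = 0 <-> Y ^+ 2 = e ^+ 2 * (X ^+ 2 - e ^+ 2).
  by rewrite /thin_hyperbola -/X -/Y; split => h; lra.
rewrite /tangent_at detE circE; split => [[/hypE h1 h2 h3]|[h1 h2 h3]].
  by split => //; move/eqP: h3; rewrite mulf_eq0 pnatr_eq0 /= => /eqP.
by split; [exact/hypE|exact: h2|rewrite h3 mulr0].
Qed.

Lemma frameK f X Y : dirx f ^+ 2 + diry f ^+ 2 = 1 ->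
  exists u v, frame_x f u v = X /\ frame_y f u v = Y.
Proof.
move=> unit_dir.
exists (ptx f + dirx f * X - diry f * Y), (pty f + diry f * X + dirx f * Y).
split; rewrite /frame_x /frame_y.
  by rewrite -[RHS]mul1r -unit_dir; ring.
by rewrite -[RHS]mul1r -unit_dir; ring.
Qed.

(** A circle of nonzero radius passes through four points at distance [r] from its center
    along the axes, which determine the center of any circle through them. *)
Lemma zero_set_circle_inj s t r s' t' r' :
  zero_set (circle_eq s t r) = zero_set (circle_eq s' t' r') ->
  [/\ s = s', t = t' & r ^+ 2 = r' ^+ 2].
Proof.
move=> eqK.
have on x y : circle_eq s t r x y = 0 <-> circle_eq s' t' r' x y = 0.
  by have := congr1 (fun K : set (R * R) => K (x, y)) eqK; rewrite /zero_set /= => ->.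
have key a b c a' b' c' : (forall x y, circle_eq a b c x y = 0 -> circle_eq a' b' c' x y = 0) ->
    c != 0 -> a = a' /\ b = b'.
  move=> sub c0; rewrite /circle_eq in sub.
  have h1 := sub (a + c) b ltac:(ring); have h2 := sub (a - c) b ltac:(ring).
  have h3 := sub a (b + c) ltac:(ring); have h4 := sub a (b - c) ltac:(ring).
  by split; apply: (mulfI c0); lra.
have [r0|r0] := eqVneq r 0; last first.
  have [ss tt] := key _ _ _ _ _ _ (fun x y => (on x y).1) r0; subst s' t'.
  split=> //; have := (on (s + r) t).1; rewrite /circle_eq => /(_ ltac:(ring)); lra.
have [r0'|r0'] := eqVneq r' 0; last first.
  have [ss tt] := key _ _ _ _ _ _ (fun x y => (on x y).2) r0'; subst s' t'.
  split=> //; have := (on (s + r') t).2; rewrite /circle_eq => /(_ ltac:(ring)); lra.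
have := (on s t).1; rewrite /circle_eq r0 r0' => /(_ ltac:(ring)).
have := sqr_ge0 (s - s'); have := sqr_ge0 (t - t') => t2 s2 h.
have /eqP : (s - s') ^+ 2 = 0 by lra.
have /eqP : (t - t') ^+ 2 = 0 by lra.
by rewrite !sqrf_eq0 !subr_eq0 => /eqP -> /eqP ->.
Qed.

Lemma tangent_circles_card e (F : 'I_3 -> pointed_line R) (c : seq (R * R * R)) :
  (forall i, dirx (F i) ^+ 2 + diry (F i) ^+ 2 = 1) ->
  uniq c -> (forall C, touching F e C <-> C \in c) ->
  (tangent_circles (thin_hyperbola e (F idx0)) (thin_hyperbola e (F idx1))
     (thin_hyperbola e (F idx2)) #= `I_(size c))%card.
Proof.
move=> unitF uniqc memc.
pose circ (C : R * R * R) : set (R * R) :=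
  zero_set (circle_eq C.1.1 C.1.2 (Num.sqrt (C.1.1 ^+ 2 + C.1.2 ^+ 2 - C.2))).
(* The contact equations do not mention the radius, but [s^2 + t^2 - g] is the squared
   distance of a contact to the center. *)
have radius C : C \in c -> 0 <= C.1.1 ^+ 2 + C.1.2 ^+ 2 - C.2.
  move=> /memc /(_ idx0) [X [Y [_ + _]]].
  rewrite /lin_along /lin_across /power.
  set dx := dirx _; set dy := diry _; set px := ptx _; set py := pty _ => h.
  have unit_dir : dx ^+ 2 + dy ^+ 2 = 1 by exact: unitF.
  pose sq := (X + (dx * (px - C.1.1) + dy * (py - C.1.2))) ^+ 2 +
    (Y + (dx * (py - C.1.2) - dy * (px - C.1.1))) ^+ 2.
  have -> : C.1.1 ^+ 2 + C.1.2 ^+ 2 - C.2 = sq.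
    have : sq = (1 * (X ^+ 2 + Y ^+ 2) + 2 * (dx * (1 * px - C.1.1) + dy * (1 * py - C.1.2)) * X +
      2 * (dx * (1 * py - C.1.2) - dy * (1 * px - C.1.1)) * Y +
      (1 * (px ^+ 2 + py ^+ 2) - 2 * (px * C.1.1 + py * C.1.2) + C.2))
      + (dx ^+ 2 + dy ^+ 2) * ((px - C.1.1) ^+ 2 + (py - C.1.2) ^+ 2)
      - (1 * (px ^+ 2 + py ^+ 2) - 2 * (px * C.1.1 + py * C.1.2) + C.2).
      by rewrite /sq; ring.
    by rewrite h unit_dir => ->; ring.
  by rewrite addr_ge0 ?sqr_ge0.
have circ_touch (s t r : R) :
  (exists u1 v1 u2 v2 u3 v3, [/\ tangent_at (thin_hyperbola e (F idx0)) (circle_eq s t r) u1 v1,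
     tangent_at (thin_hyperbola e (F idx1)) (circle_eq s t r) u2 v2 &
     tangent_at (thin_hyperbola e (F idx2)) (circle_eq s t r) u3 v3]) <->
  (s, t, s ^+ 2 + t ^+ 2 - r ^+ 2) \in c.
  split=> [[u1 [v1 [u2 [v2 [u3 [v3 [T1 T2 T3]]]]]]]|/memc touchC].
    apply/memc; elim/idx_cases; do 2 eexists.
    - by apply/tangent_atP; [exact: unitF|exact: T1].
    - by apply/tangent_atP; [exact: unitF|exact: T2].
    - by apply/tangent_atP; [exact: unitF|exact: T3].
  have pt k : exists u v, tangent_at (thin_hyperbola e (F k)) (circle_eq s t r) u v.
    have [X [Y touch]] := touchC k; have [u [v [uX vY]]] := frameK X Y (unitF k).
    by exists u, v; apply/tangent_atP; [exact: unitF|rewrite uX vY].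
  have [u1 [v1 T1]] := pt idx0; have [u2 [v2 T2]] := pt idx1; have [u3 [v3 T3]] := pt idx2.
  by exists u1, v1, u2, v2, u3, v3.
have sqrtK C : C \in c -> C.1.1 ^+ 2 + C.1.2 ^+ 2 -
    Num.sqrt (C.1.1 ^+ 2 + C.1.2 ^+ 2 - C.2) ^+ 2 = C.2.
  by move=> Cc; rewrite sqr_sqrtr ?radius//; ring.
apply/card_esym/card_set_bijP; exists (fun i => circ (nth (0, 0, 0) c i)); split.
- move=> i /= ic; have Cc : nth (0, 0, 0) c i \in c by exact: mem_nth.
  rewrite /circ; do 3 eexists; split; first by [].
  apply/circ_touch; rewrite sqrtK//.
  by case: (nth _ _ _) Cc => [[]].
- move=> i j /=; rewrite !inE /= => ic jc /zero_set_circle_inj [E1 E2 E3].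
  have Ci : nth (0, 0, 0) c i \in c by exact: mem_nth.
  have Cj : nth (0, 0, 0) c j \in c by exact: mem_nth.
  apply/eqP; rewrite -(nth_uniq (0, 0, 0) ic jc uniqc); apply/eqP.
  have E4 : (nth (0, 0, 0) c i).2 = (nth (0, 0, 0) c j).2.
    by rewrite -(sqrtK _ Ci) -(sqrtK _ Cj) E3 E1 E2.
  move: E1 E2 E4.
  by case: (nth _ _ i) => [[? ?] ?]; case: (nth _ _ j) => [[? ?] ?] /= -> -> ->.
- move=> K [s [t [r [-> /circ_touch Cc]]]].
  exists (index (s, t, s ^+ 2 + t ^+ 2 - r ^+ 2) c); first by rewrite /= index_mem.
  rewrite nth_index// /circ /=.
  have -> : s ^+ 2 + t ^+ 2 - (s ^+ 2 + t ^+ 2 - r ^+ 2) = r ^+ 2 by ring.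
  by rewrite sqrtr_sqr /circle_eq real_normK ?num_real.
Qed.

End Bridge.

(** * Three lines and three points with seventeen limit circles *)

Section QuadraticRoots.
Variable R : realType.
Implicit Types p q x : R.

Definition quadratic_roots p q : seq R :=
  [:: - p / 2 + Num.sqrt (p ^+ 2 / 4 - q); - p / 2 - Num.sqrt (p ^+ 2 / 4 - q)].

Lemma quadratic_rootsP p q x : 0 < p ^+ 2 / 4 - q ->
  x \in quadratic_roots p q <-> x ^+ 2 + p * x + q = 0.
Proof.
move=> d0; rewrite !inE; set r := Num.sqrt _.
have r2 : r ^+ 2 = p ^+ 2 / 4 - q by rewrite sqr_sqrtr// ltW.
split=> [/orP[] /eqP ->|h]; [by lra|by lra|].
have /eqP : (x + p / 2) ^+ 2 = r ^+ 2 by rewrite r2; lra.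
by rewrite eqf_sqr => /orP[] /eqP xr; apply/orP; [left|right]; apply/eqP; lra.
Qed.

Lemma quadratic_roots_uniq p q : 0 < p ^+ 2 / 4 - q -> uniq (quadratic_roots p q).
Proof.
move=> d0; rewrite /= andbT inE; apply/eqP.
have : 0 < Num.sqrt (p ^+ 2 / 4 - q) by rewrite sqrtr_gt0.
lra.
Qed.

End QuadraticRoots.

Section Configuration.
Variable R : realType.
Local Notation types := {ffun 'I_3 -> bool}.

(** The direction of the third side is rational, thanks to the 3-4-5 triangle.  Each pair
    of points lies on one side of the remaining line, which makes the two circles
    through the pair touching this line real. *)
Definition config (k : 'I_3) : pointed_line R :=
  nth (PointedLine 0 0 0 0)
    [:: PointedLine 1 0 1 0; PointedLine 0 1 0 1; PointedLine 4 3 (- 4 / 5) (3 / 5)] k.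

Lemma config_generic : generic_lines config.
Proof.
split.
- by elim/idx_cases => /=; lra.
- by elim/idx_cases; elim/idx_cases => //= _; rewrite /cross; apply/eqP; lra.
- by elim/idx_cases; elim/idx_cases; elim/idx_cases => //= _; rewrite /cross; apply/eqP; lra.
- by rewrite /cross /=; apply/eqP; lra.
Qed.

Definition types_of (b : bool * bool * bool) : types :=
  [ffun k : 'I_3 => nth false [:: b.1.1; b.1.2; b.2] k].

(** The circle touches the first two sides when [t^2 = r^2] and [s^2 = r^2], respectively;
    passing through the marked points is linear in the coordinates of the circle. *)
Lemma limit_circleE b (s t g : R) : limit_circle config (types_of b) s t g <->
  [/\ if b.1.1 then g = s ^+ 2 else g = 2 * s - 1,
      if b.1.2 then g = t ^+ 2 else g = 2 * t - 1 &
      if b.2 then (4 * s - 3 * t - 7) ^+ 2 = 25 * (25 - 8 * s - 6 * t + g)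
      else g = 8 * s + 6 * t - 25].
Proof.
case: b => [[b0 b1] b2] /=; split=> [lim|[h0 h1 h2]].
  have := lim idx0; have := lim idx1; have := lim idx2.
  rewrite /limit_contact !ffunE /= /lin_along /power /= => h2 h1 h0; split.
  - by case: b0 h0 {lim} => h0; lra.
  - by case: b1 h1 {lim} => h1; lra.
  - by case: b2 h2 {lim} => h2; lra.
elim/idx_cases; rewrite /limit_contact ffunE /= /lin_along /power /=.
- by case: b0 h0 => h0; lra.
- by case: b1 h1 => h1; lra.
- by case: b2 h2 => h2; lra.
Qed.

(** In each mixed case, the linear conditions given by the points and, when two lines are
    touched, the equation of one of their bisectors express the circle through one
    coordinate of its center, which then satisfies a quadratic equation. *)
Definition limit_list (b : bool * bool * bool) : seq (R * R * R) :=
  match b with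
  | (true, true, true) => [:: (2, 2, 4); (12, 12, 144); (6, - 6, 36); (- 4, 4, 16)]
  | (false, true, true) =>
      [seq (x, 6 - 2 * x, 2 * x - 1) | x <- quadratic_roots (- 13 / 2) (37 / 4)]
  | (true, false, true) =>
      [seq (8 - 3 * x, x, 2 * x - 1) | x <- quadratic_roots (- 50 / 9) (65 / 9)]
  | (true, true, false) => [seq (x, x, x ^+ 2) | x <- quadratic_roots (- 14) 25]
  | (false, false, true) => [seq (x, x, 2 * x - 1) | x <- quadratic_roots 286 (- 551)]
  | (false, true, false) => [seq (4 - x, x, x ^+ 2) | x <- quadratic_roots 2 (- 7)]
  | (true, false, false) => [seq (x, 6 - 2 * x, x ^+ 2) | x <- quadratic_roots 4 (- 11)]
  | (false, false, false) => [:: (2, 2, 3)]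
  end.

Lemma mem_roots_map (f : R -> R * R * R) p q C : 0 < p ^+ 2 / 4 - q ->
  C \in [seq f x | x <- quadratic_roots p q] <->
  exists2 x, x ^+ 2 + p * x + q = 0 & C = f x.
Proof.
move=> d0; split=> [/mapP [x /(quadratic_rootsP x d0) ? ->]|[x hx ->]]; first by exists x.
by apply/map_f/quadratic_rootsP.
Qed.

(** When two lines are touched, the center lies on one of their bisectors; if the
    third contact is with a point, only the bisector of the sector that contains
    the point has a real solution. *)
Lemma limit_listP b (s t g : R) :
  (s, t, g) \in limit_list b <-> limit_circle config (types_of b) s t g.
Proof.
have pairE (s' t' g' : R) : s = s' -> t = t' -> g = g' -> (s, t, g) = (s', t', g').
  by move=> -> -> ->.
apply: (iff_trans _ (iff_sym (limit_circleE b s t g))).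
case: b => [[[] []] []]; rewrite /limit_list; cbn beta iota delta [fst snd].
- split=> [|[gs gt h]].
    by rewrite !inE => /or4P[] /eqP [-> -> ->]; split; lra.
  have /eqP : s ^+ 2 = t ^+ 2 by rewrite -gs -gt.
  rewrite eqf_sqr !inE => /orP[] /eqP st.
    have /eqP : (s - 2) * (s - 12) = 0 by rewrite gs st in h *; lra.
    rewrite mulf_eq0 => /orP[] /eqP hs; apply/or4P.
      by apply: Or41; apply/eqP/pairE; rewrite ?gs; nra.
    by apply: Or42; apply/eqP/pairE; rewrite ?gs; nra.
  have /eqP : (s - 6) * (s + 4) = 0 by rewrite gs st in h *; lra.
  rewrite mulf_eq0 => /orP[] /eqP hs; apply/or4P.
    by apply: Or43; apply/eqP/pairE; rewrite ?gs; nra.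
  by apply: Or44; apply/eqP/pairE; rewrite ?gs; nra.
- apply: (iff_trans (mem_roots_map _ _ _)); first by lra.
  split=> [[x hx [-> -> ->]]|[gs gt h]]; first by split; lra.
  have /eqP : s ^+ 2 = t ^+ 2 by rewrite -gs -gt.
  rewrite eqf_sqr => /orP[] /eqP st.
    by exists s; [lra|apply: pairE].
  by have := sqr_ge0 (s - 1); nra.
- apply: (iff_trans (mem_roots_map _ _ _)); first by lra.
  split=> [[x hx [-> -> ->]]|[gs gt h]]; first by split; lra.
  have /eqP : (3 * s + 4 * t - 24) ^+ 2 = (5 * t) ^+ 2 by lra.
  rewrite eqf_sqr => /orP[] /eqP st.
    by have := sqr_ge0 (s - 3); have tE : t = 3 * s - 24 by [lra]; rewrite tE in gt; lra.
  have sE : s = 8 - 3 * t by lra.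
  by exists t; [rewrite sE in gs; lra|apply: pairE].
- apply: (iff_trans (mem_roots_map _ _ _)); first by lra.
  split=> [[x hx [-> -> ->]]|[gs gt h]]; first by split; lra.
  have tE : t = 6 - 2 * s by lra.
  by exists s; [lra|apply: pairE].
- apply: (iff_trans (mem_roots_map _ _ _)); first by lra.
  split=> [[x hx [-> -> ->]]|[gs gt h]]; first by split; lra.
  have /eqP : (3 * s + 4 * t - 24) ^+ 2 = (5 * s) ^+ 2 by lra.
  rewrite eqf_sqr => /orP[] /eqP st.
    by have := sqr_ge0 (s + 8); have tE : t = 6 + s / 2 by [lra]; rewrite tE in gt; lra.
  have tE : t = 6 - 2 * s by lra.
  by exists s; [rewrite tE in gt; lra|apply: pairE].
- apply: (iff_trans (mem_roots_map _ _ _)); first by lra.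
  split=> [[x hx [-> -> ->]]|[gs gt h]]; first by split; lra.
  have sE : s = 4 - t by lra.
  by exists t; [lra|apply: pairE].
- apply: (iff_trans (mem_roots_map _ _ _)); first by lra.
  split=> [[x hx [-> -> ->]]|[gs gt h]]; first by split; lra.
  have tE : t = s by lra.
  by exists s; [rewrite tE gs in h; lra|apply: pairE].
- rewrite inE; split=> [/eqP [-> -> ->]|[gs gt h]]; first by split; lra.
  by apply/eqP/pairE; lra.
Qed.

Lemma limit_list_uniq b : uniq (limit_list b).
Proof.
have map_uniq (f : R -> R * R * R) p q : 0 < p ^+ 2 / 4 - q -> injective f ->
    uniq [seq f x | x <- quadratic_roots p q].
  by move=> d0 f_inj; rewrite map_inj_uniq// quadratic_roots_uniq.
case: b => [[[] []] []]; rewrite /limit_list.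
- rewrite /= !inE !xpair_eqE.
  have ne (a b : R) : a < b \/ b < a -> (a == b) = false.
    by move=> [ab|ab]; apply/eqP; lra.
  by rewrite !(@ne 2) ?(@ne 12) ?(@ne 6) //; lra.
- by apply: map_uniq; [lra|move=> x y []].
- by apply: map_uniq; [lra|move=> x y []].
- by apply: map_uniq; [lra|move=> x y []].
- by apply: map_uniq; [lra|move=> x y []].
- by apply: map_uniq; [lra|move=> x y []].
- by apply: map_uniq; [lra|move=> x y []].
- by [].
Qed.

End Configuration.

Section Regularity.
Variable R : realType.

(** An affine expression in a root [x] of a quadratic equation: if it vanished, its square
    and the equation would give a contradiction linear in the monomials 1, [x], [x^2]. *)
Ltac root_neq0 := let h := fresh in apply/eqP => h;
  have := congr1 (fun z => z ^+ 2) h; rewrite expr0n /=; lra.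

(** The determinant of the contact points has degree at most 2 in [x] and is first reduced, modulo
    the quadratic equation, to the given affine expression. *)
Ltac root_combination a b := let h := fresh in
  lazymatch goal with hx : ?x ^+ 2 + _ * ?x + _ = 0 |- is_true (?y != 0) =>
    have h : y = a * x + b; [lra | rewrite h; root_neq0] end.

Ltac regular_at_root a b := split;
  [ elim/idx_cases; rewrite /lin_along /=; root_neq0
  | elim/idx_cases; rewrite ffunE //= => _; rewrite /lin_across /=; root_neq0
  | rewrite /contact_px /contact_py !ffunE /cross /lin_along /=; root_combination a b ].

Lemma limit_list_regular b (s t g : R) :
  (s, t, g) \in limit_list R b -> regular_circle (config R) (types_of b) s t.
Proof.
case: b => [[[] []] []]; rewrite /limit_list.
- rewrite !inE => /or4P[] /eqP [-> -> _]; split; try by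
    [ elim/idx_cases; rewrite /lin_along /=; apply/eqP; lra
    | elim/idx_cases => _; rewrite /lin_across /=; apply/eqP; lra
    | rewrite /contact_px /contact_py !ffunE /cross /lin_along /=; apply/eqP; lra].
- move/mem_roots_map => -[|x hx [-> -> _]]; first by lra.
  by regular_at_root (7 : R) (- 25 : R).
- move/mem_roots_map => -[|x hx [-> -> _]]; first by lra.
  by regular_at_root (15 : R) (- 39 : R).
- move/mem_roots_map => -[|x hx [-> -> _]]; first by lra.
  by regular_at_root (- 2 : R) (- 4 : R).
- move/mem_roots_map => -[|x hx [-> -> _]]; first by lra.
  by regular_at_root (52 / 5 : R) (- 148 / 5 : R).
- move/mem_roots_map => -[|x hx [-> -> _]]; first by lra.
  by regular_at_root (- 3 : R) (- 3 : R).
- move/mem_roots_map => -[|x hx [-> -> _]]; first by lra.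
  by regular_at_root (- 1 / 25 : R) (- 143 / 25 : R).
- rewrite inE => /eqP [-> -> _]; split.
  + by elim/idx_cases; rewrite /lin_along /=; apply/eqP; lra.
  + by elim/idx_cases; rewrite ffunE.
  + by rewrite /contact_px /contact_py !ffunE /cross /lin_along /=; apply/eqP; lra.
Qed.

End Regularity.

Definition all_types : seq (bool * bool * bool) :=
  [seq (b01, b2) | b01 <- [seq (b0, b1) | b0 <- [:: true; false], b1 <- [:: true; false]],
                   b2 <- [:: true; false]].

Definition limit_circles (R : realType) : seq ({ffun 'I_3 -> bool} * (R * R * R)) :=
  [seq (types_of b, C) | b <- all_types, C <- limit_list R b].

Lemma mem_all_types b : b \in all_types.
Proof. by case: b => [[[] []] []]. Qed.

Lemma types_of_inj : injective types_of.
Proof.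
move=> [[b0 b1] b2] [[c0 c1] c2] /ffunP E.
by have := E idx0; have := E idx1; have := E idx2; rewrite !ffunE /= => -> -> ->.
Qed.

Lemma types_of_surj (l : {ffun 'I_3 -> bool}) : l = types_of (l idx0, l idx1, l idx2).
Proof. by apply/ffunP; elim/idx_cases; rewrite ffunE. Qed.

Lemma mem_limit_circles (R : realType) (l : {ffun 'I_3 -> bool}) (C : R * R * R) :
  (l, C) \in limit_circles R <-> limit_circle (config R) l C.1.1 C.1.2 C.2.
Proof.
case: C => [[s t] g]; split=> [/allpairsPdep [b [C [_ Cb [-> E]]]]|lim].
  by apply/limit_listP; rewrite E.
apply/allpairsPdep; exists (l idx0, l idx1, l idx2), (s, t, g).
split; [exact: mem_all_types| |by rewrite -types_of_surj].
by apply/limit_listP; rewrite -types_of_surj.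
Qed.

Lemma limit_circles_regular (R : realType) (l : {ffun 'I_3 -> bool}) (C : R * R * R) :
  (l, C) \in limit_circles R -> regular_circle (config R) l C.1.1 C.1.2.
Proof.
case: C => [[s t] g] /allpairsPdep [b [C [_ Cb [-> E]]]].
by apply: (@limit_list_regular _ _ _ _ g); rewrite E.
Qed.

Lemma limit_circles_uniq (R : realType) : uniq (limit_circles R).
Proof.
apply: allpairs_uniq_dep => [//|b _|]; first exact: limit_list_uniq.
by move=> [b C] [b' C'] _ _ [/types_of_inj -> ->].
Qed.

Lemma size_limit_circles (R : realType) : size (limit_circles R) = 17.
Proof. by []. Qed.

Theorem theorem1p3 (R : realType) :
  exists Q1 Q2 Q3 : R -> R -> R,
    [/\ real_conic Q1, real_conic Q2, real_conic Q3
      & (tangent_circles Q1 Q2 Q3 #= `I_136)%card].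
Proof.
have unit_dir := dir_unit (config_generic R).
have count := touching_circles_counted (config_generic R) (limit_circles_uniq R)
  (@mem_limit_circles R) (@limit_circles_regular R).
have pos : \forall e \near 0^'+, (0 : R) < e by exact: nbhs_right_gt.
have both := @filterI _ 0^'+ _ _ _ count pos.
have [e [[r [uniqr sizer memr]] e0]] := @filter_ex _ 0^'+ _ _ (both _).
have e_neq0 : e != 0 by rewrite gt_eqF.
exists (thin_hyperbola e (config R idx0)), (thin_hyperbola e (config R idx1)),
  (thin_hyperbola e (config R idx2)).
split; try exact: thin_hyperbola_real_conic.
have := tangent_circles_card unit_dir uniqr memr.
by rewrite sizer size_limit_circles.
Qed.
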